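(* Let $(X_{n,j})_{n,j\in\mathbb{N}}$ be a family of independent random variables, each uniformly distributed on $[0,1)$. Let $\alpha>1$ and $\beta>1$ satisfy $(\zeta(\alpha)-1)(\zeta(\beta)-1)<1$, where $\zeta$ is the Riemann zeta function. Let $B=178$ and let $A_s$ ($s\in\mathbb{N}$) be the constants defined in the context. Then $$\mathbb{P}\left(D_N^{*s}(\mathcal{P}_{N,s})\le \sqrt{\alpha A_s+\beta B\,\frac{\ln(\log_2 N)}{s}}\,\sqrt{\frac{s}{N}}\ \text{ for all } s\in\mathbb{N} \text{ and all } N\ge 2\right)>1-(\zeta(\alpha)-1)(\zeta(\beta)-1).$$ Moreover, $A_2\le 942$.
   Context: For $s,N\in\mathbb{N}$, $\mathcal{P}_{N,s}$ denotes the finite sequence of $N$ points $X^{(n)}_s=(X_{n,1},\dots,X_{n,s})\in[0,1)^s$, $n=1,\dots,N$ (the upper-left $N\times s$ block of the matrix, rows read as points). For points $x_1,\dots,x_N\in[0,1)^s$, the star-discrepancy is $$D_N^{*s}(x_1,\dots,x_N)=\sup_{y\in[0,1]^s}\left|\frac1N\sum_{k=1}^N \mathbf{1}_{[0,y)}(x_k)-\lambda([0,y))\right|,$$ where $[0,y)=\{z\in[0,1)^s: 0\le z<y\}$ (componentwise) and $\lambda$ is $s$-dimensional Lebesgue measure. Define $b_{-1}=b_0=3$ and $b_k=2^{-k+3}(1-2^{-k})$ for $k\ge1$. Let $C_s=\max\{1,1.1^{s-101}\}$. For $k\ge0$ set $$a_{k,s}=b_k\left(\frac{\ln\!\left(C_s\,2^{k+2}\sqrt{2/\pi}\right)}{s}+\ln\!\left(2e(2^{k+1}+1)\right)\right),$$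 and $a_{-1,s}=a_{0,s}$. Put $A_s=2\left(\sum_{k=-1}^{\infty}\sqrt{a_{k,s}}\right)^2$. *)

(* Defs.v *)
From HB Require Import structures.
From mathcomp Require Import all_boot all_order all_algebra.
From mathcomp Require Import all_classical all_reals all_analysis.
Set Implicit Arguments. Unset Strict Implicit. Unset Printing Implicit Defensive.
Import Order.TTheory GRing.Theory Num.Theory.
Import numFieldNormedType.Exports.
Local Open Scope classical_set_scope.
Local Open Scope ring_scope.

Section Defs.
Variable R : realType.

Definition zeta (a : R) : R := limn (fun n => \sum_(1 <= k < n) (k%:R `^ (- a))).

(* b_{-1} = b_0 = 3, b_k = 2^{-k+3} (1 - 2^{-k}) for k >= 1 (indexed here by k >= 0) *)
Definition b_coef (k : nat) : R :=
  if k == 0%N then 3 else 2 `^ (3 - k%:R) * (1 - 2 `^ (- k%:R)).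

Definition C_const (s : nat) : R := Num.max 1 ((11 / 10) `^ (s%:R - 101)).

Definition a_coef (k s : nat) : R :=
  b_coef k * (ln (C_const s * 2 ^+ (k + 2) * Num.sqrt (2 / pi)) / s%:R
              + ln (2 * expR 1 * (2 ^+ k.+1 + 1))).

(* A_s = 2 (sum_{k=-1}^oo sqrt(a_{k,s}))^2 with a_{-1,s} = a_{0,s} *)
Definition A_const (s : nat) : R :=
  2 * (Num.sqrt (a_coef 0 s) + limn (fun n => \sum_(0 <= k < n) Num.sqrt (a_coef k s))) ^+ 2.

Definition star_discrepancy (s N : nat) (x : nat -> 'I_s -> R) : R :=
  sup [set r : R | exists y : 'I_s -> R, (forall i, 0 <= y i <= 1) /\
     r = `| (N%:R)^-1 * (#|[set k : 'I_N | [forall i, (0 <= x k i) && (x k i < y i)]]|)%:R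
            - \prod_(i < s) y i | ].

Definition log2 (x : R) : R := ln x / ln 2.

Variables (d : measure_display) (T : measurableType d) (P : probability T R).

Definition mutually_independent (I : eqType) (X : I -> T -> R) : Prop :=
  forall (J : seq I) (B : I -> set R), uniq J ->
    (forall i, i \in J -> measurable (B i)) ->
    P (\bigcap_(i in [set i | i \in J]) (X i @^-1` B i)) =
    (\prod_(i <- J) P (X i @^-1` B i))%E.

Definition uniform01 (X : T -> R) : Prop :=
  measurable_fun setT X /\
  forall A : set R, measurable A ->
    P (X @^-1` A) = (@lebesgue_measure R) (A `&` `[0, 1[).

End Defs.

Arguments b_coef {R} k.
Arguments C_const {R} s.
Arguments a_coef {R} k s.
Arguments A_const {R} s.
Arguments star_discrepancy {R} s N x.

(* Main.v *)
(**
  The constants leave so much room that only the lower bound A_s >= 200 is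
  needed for the probabilistic part: with H = 200 alpha s + 178 beta ln M, it
  suffices that for each dyadic block 2^M <= N < 2^(M+1) the bound
  D_N <= sqrt (H / N) fails with probability at most
  (s+1)^(-alpha) (M+1)^(-beta) / 2, since these numbers sum to
  (zeta(alpha) - 1) (zeta(beta) - 1) / 2.

  If H >= 2^(M+1) the bound exceeds 1 and is trivial.  Otherwise one chains along
  grids of resolution 64^(-k): the grid of level k has at most (512^k e)^s
  points, and every box is bracketed between two grid boxes whose volumes differ
  from its own by at most 64^(-k).  Each grid point of level j+1 is compared with
  a lower grid point of level j; the number of sample points in the difference of
  the two boxes is a centred Bernoulli walk of variance at most 16^(-j) / 4 per
  step, whose maximum over the whole block is controlled by an exponential
  (Doob-Bernstein) inequality obtained from e^x <= 1 + x + x^2.  A deviation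
  of 3/8 2^(-j) sqrt (H 2^M) at level j then costs exp (- 9/128 4^j H), which
  beats the number of grid points; the chain stops once the resolution falls
  below sqrt (H / 2^M) / 8.

  Independence of the differences of boxes follows from that of the coordinates
  because the product rule is inherited by proper set differences.  The bound on
  A_2 is an explicit estimate of the first 24 terms and a geometric tail.
*)
Require Import Defs.
From HB Require Import structures.
From mathcomp Require Import all_boot all_order all_algebra.
From mathcomp Require Import all_classical all_reals all_analysis.
From mathcomp Require Import ring lra zify.
Import Order.TTheory GRing.Theory Num.Theory.
Import numFieldNormedType.Exports.
Local Open Scope classical_set_scope.
Local Open Scope ring_scope.

(** * Elementary bounds for the exponential and the logarithm *)

Section RealPreliminaries.
Variable R : realType.
Implicit Types x y q a : R.

Lemma expR_ge_sum n x : 0 <= x -> \sum_(i < n) x ^+ i / i`!%:R <= expR x.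
Proof.
move=> x0; rewrite -(big_mkord xpredT (fun i => x ^+ i / i`!%:R)).
apply: (@nondecreasing_cvgn_le R (series (exp_coeff x))).
  apply/nondecreasing_seqP => k; rewrite /series/= big_nat_recr//= lerDl.
  by rewrite /exp_coeff/= divr_ge0 ?exprn_ge0.
exact: is_cvg_series_exp_coeff.
Qed.

(** From [exp (-x/3) >= 1 - x/3] follows [exp x <= (1 - x/3)^-3]; what remains is the polynomial
    inequality [(1 + x + x^2) (1 - x/3)^3 >= 1], whose nontrivial factor stays positive up to
    [x = 3/5]. *)
Lemma expR_le_quad x : `|x| <= 3/5 -> expR x <= 1 + x + x ^+ 2.
Proof.
rewrite ler_norml => /andP[x1 x2].
have e1 : expR x * expR (- (x / 3)) ^+ 3 = 1.
  rewrite -expRM_natl -expRD [X in expR X](_ : _ = 0) ?expR0//; lra.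
have e2 : 1 - x / 3 <= expR (- (x / 3)) by exact: expR_ge1Dx.
have e3 : (1 - x / 3) ^+ 3 <= expR (- (x / 3)) ^+ 3 by rewrite lerXn2r ?nnegrE; lra.
have e4 : 0 < (1 - x / 3) ^+ 3 by rewrite exprn_gt0//; lra.
have e5 : expR x * (1 - x / 3) ^+ 3 <= 1.
  by rewrite -[leRHS]e1 ler_wpM2l ?expR_ge0.
rewrite -(ler_pM2r e4); apply: (le_trans e5).
have -> : (1 + x + x ^+ 2) * (1 - x / 3) ^+ 3 =
  1 + x ^+ 2 * (1 / 3 - 19 / 27 * x + x ^+ 2 * (8 - x) / 27) by field.
rewrite lerDl mulr_ge0 ?sqr_ge0//; have := sqr_ge0 x; nra.
Qed.

Lemma ln_le_expR x q : 0 < x -> x <= expR q -> ln x <= q.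
Proof. by move=> x0; rewrite -{1}(@lnK _ x) ?posrE// ler_expR. Qed.

Lemma ln_ge_expR x q : expR q <= x -> q <= ln x.
Proof.
move=> h; have x0 : 0 < x by rewrite (lt_le_trans (expR_gt0 q)).
by rewrite -(@lnK _ x) ?posrE// ler_expR in h.
Qed.

(* [exp (-q/n) >= 1 - q/n] *)
Lemma expR_le_pow n q x : 0 < x -> q < n.+1%:R ->
  1 <= x * (1 - q / n.+1%:R) ^+ n.+1 -> expR q <= x.
Proof.
move=> x0 qn h.
have e1 : expR q * expR (- (q / n.+1%:R)) ^+ n.+1 = 1.
  by rewrite -expRM_natl -expRD mulrN [X in - X]mulrC divfK ?pnatr_eq0// subrr expR0.
have p : 0 < 1 - q / n.+1%:R by rewrite subr_gt0 ltr_pdivrMr ?mul1r ?ltr0n.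
have e3 : (1 - q / n.+1%:R) ^+ n.+1 <= expR (- (q / n.+1%:R)) ^+ n.+1.
  by rewrite lerXn2r ?nnegrE ?expR_ge0 ?(ltW p) ?expR_ge1Dx.
rewrite -(ler_pM2r (exprn_gt0 n.+1 (expR_gt0 (- (q / n.+1%:R))))) e1.
by rewrite (le_trans h) ?ler_pM2l.
Qed.

(** * Sine and cosine estimates, and a lower bound for pi *)

Lemma sin_le x : 0 <= x -> sin x <= x.
Proof.
move=> x0.
have [|c _] := @MVT_segment R sin cos 0 x x0 (fun y _ => is_derive_sin y).
  by apply: continuous_subspaceT => y; exact: continuous_sin.
rewrite sin0 !subr0 => ->; rewrite -[leRHS]mul1r ler_wpM2r//; exact: cos_le1.
Qed.

Lemma cos_ge x : 0 <= x -> x <= 1 -> 1 - x ^+ 2 / 2 <= cos x.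
Proof.
move=> x0 x1; have -> : x = (x / 2) *+ 2 by lra.
rewrite cos_mulr2n cos2sin2.
have s1 : sin (x / 2) <= x / 2 by apply: sin_le; lra.
have s0 : 0 <= sin (x / 2).
  by apply: sin_ge0_pi; have := pi_ge2 R; lra.
nra.
Qed.

Lemma cos_double_ge x c c' :
  0 <= c -> c <= cos x -> c' <= c ^+ 2 *+ 2 - 1 -> c' <= cos (x *+ 2).
Proof.
move=> c0 cx h; rewrite cos_mulr2n (le_trans h)// lerD2r lerMn2r/=.
by rewrite lerXn2r ?nnegrE// (le_trans c0).
Qed.

(* Decimals are written in groups of two digits because numerals are unary. *)
Lemma pi_gt_314 : 314 / 100 < pi :> R.
Proof.
(* [t] is 1.57 / 32: five doublings of the angle carry the quadratic bound at [t] to 1.57, where the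
   cosine turns out positive. Each doubling rounds its lower bound down. *)
pose t : R := 157 / 3200.
have c0 : 99 / 10 ^+ 2 + 87 / 10 ^+ 4 + 96 / 10 ^+ 6 + 43 / 10 ^+ 8 <= cos t.
  by apply: (le_trans _ (@cos_ge t _ _)); rewrite /t; lra.
have c1 : 99 / 10 ^+ 2 + 51 / 10 ^+ 4 + 88 / 10 ^+ 6 + 61 / 10 ^+ 8 <= cos (t *+ 2).
  by apply: (cos_double_ge _ _ _ _ c0); lra.
have c2 : 98 / 10 ^+ 2 + 8 / 10 ^+ 4 + 0 / 10 ^+ 6 + 73 / 10 ^+ 8 <= cos (t *+ 2 *+ 2).
  by apply: (cos_double_ge _ _ _ _ c1); lra.
have c3 : 92 / 10 ^+ 2 + 39 / 10 ^+ 4 + 40 / 10 ^+ 6 + 14 / 10 ^+ 8 <= cos (t *+ 2 *+ 2 *+ 2).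
  by apply: (cos_double_ge _ _ _ _ c2); lra.
have c4 : 70 / 10 ^+ 2 + 73 / 10 ^+ 4 + 30 / 10 ^+ 6 + 76 / 10 ^+ 8 <= cos (t *+ 2 *+ 2 *+ 2 *+ 2).
  by apply: (cos_double_ge _ _ _ _ c3); lra.
have c5 : 0 / 10 ^+ 2 + 6 / 10 ^+ 4 + 33 / 10 ^+ 6 + 60 / 10 ^+ 8 <= cos (t *+ 2 *+ 2 *+ 2 *+ 2 *+ 2).
  by apply: (cos_double_ge _ _ _ _ c4); lra.
have cp : 0 < cos (157 / 100 : R).
  by rewrite (_ : 157 / 100 = t *+ 2 *+ 2 *+ 2 *+ 2 *+ 2); [lra|rewrite /t; lra].
rewrite ltNge; apply/negP => pile.
(* If [pi <= 3.14], then [1.57 - pi] lies in [[-pi/2, pi/2]], where cosine is nonnegative; but its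
   cosine is [- cos 1.57 < 0]. *)
have := @cos_ge0_pihalf R (157 / 100 - pi).
rewrite cosB cospi sinpi => /(_ _); have := pi_ge2 R; have := pihalf_02 R; lra.
Qed.

(** * Sums of nonnegative terms and the zeta series *)

Lemma nondecreasing_sum_nat (u : nat -> R) m : (forall i, 0 <= u i) ->
  nondecreasing_seq (fun n => \sum_(m <= k < n) u k).
Proof.
move=> u0; apply/nondecreasing_seqP => n.
have [mn|nm] := leqP m n; first by rewrite big_nat_recr//= lerDl.
by rewrite big_geq 1?ltnW// sumr_ge0.
Qed.

(** [limn] carries no information for a divergent sequence, so the uniform bound [M] serves both
    conclusions: it gives convergence by monotonicity. *)
Lemma sum_nat_lim_bound (u : nat -> R) m M : (forall i, 0 <= u i) ->
  (forall n, \sum_(m <= k < n) u k <= M) ->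
  (forall n, \sum_(m <= k < n) u k <= limn (fun n => \sum_(m <= k < n) u k)) /\
  limn (fun n => \sum_(m <= k < n) u k) <= M.
Proof.
move=> u0 uM; have cv : cvgn (fun n => \sum_(m <= k < n) u k).
  apply: nondecreasing_is_cvgn; first exact: nondecreasing_sum_nat.
  by exists M => _ [n _ <-].
split; last by apply: limr_le => //; near=> n.
by move=> n; apply: nondecreasing_cvgn_le => //; exact: nondecreasing_sum_nat.
Unshelve. all: by end_near. Qed.

Lemma sum_geometric_le (z : R) n : 0 <= z -> z < 1 ->
  \sum_(0 <= k < n) z ^+ k <= (1 - z)^-1.
Proof.
move=> z0 z1; elim: n => [|n IH].
  by rewrite big_geq// invr_ge0 subr_ge0 ltW.
rewrite big_nat_recl//=; under eq_bigr do rewrite exprS.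
rewrite -big_distrr/=; have z2 : 0 < 1 - z by rewrite subr_gt0.
apply: (@le_trans _ _ (1 + z * (1 - z)^-1)); first by rewrite expr0 lerD2l ler_wpM2l.
by rewrite -(ler_pM2r z2) mulrDl mul1r mulfVK ?gt_eqF// mulVf ?gt_eqF// subrK.
Qed.

(** Cauchy condensation: the block from [2^n] to [2^(n+1)] has [2^n] terms, each at most
    [(2^n)^(-a)]. *)
Lemma sum_powRN_dyadic a n : 0 <= a ->
  \sum_(1 <= k < 2 ^ n) (k%:R `^ (- a)) <= \sum_(0 <= k < n) (2 `^ (1 - a)) ^+ k.
Proof.
move=> a0; elim: n => [|n IH]; first by rewrite expn0 !big_geq.
rewrite (@big_cat_nat _ _ _ (2 ^ n))/= ?leq_exp2l ?expn_gt0// big_nat_recr//= lerD//.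
have -> : (2 `^ (1 - a)) ^+ n = \sum_(2 ^ n <= k < 2 ^ n.+1) ((2 ^ n)%:R `^ (- a)).
  rewrite sumr_const_nat expnS mul2n -addnn addnK -[RHS]mulr_natr.
  have -> : (2 ^ n)%:R = 2 `^ n%:R :> R by rewrite natrX powR_mulrn.
  rewrite -powRrM -[LHS]powR_mulrn ?powR_ge0// -powRrM -powRD ?pnatr_eq0 ?implybT//.
  by congr (_ `^ _); ring.
rewrite big_nat_cond [leRHS]big_nat_cond; apply: ler_sum => k /andP[/andP[k1 k2] _].
have p0 : (0 < 2 ^ n)%N by rewrite expn_gt0.
rewrite !powRN lef_pV2 ?posrE ?powR_gt0 ?ltr0n//; last exact: leq_trans k1.
by apply: ge0_ler_powR; rewrite ?nnegrE ?ler0n// ler_nat.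
Qed.

Lemma sum_powRN_le_zeta a n : 1 < a -> \sum_(1 <= k < n) (k%:R `^ (- a)) <= zeta a.
Proof.
move=> a1; have z1 : 2 `^ (1 - a) < 1 :> R.
  rewrite /powR pnatr_eq0/= expR_lt1 nmulr_rlt0 ?ln_gt0 ?ltr1n//; lra.
have [h _] : (forall n, \sum_(1 <= k < n) (k%:R `^ (- a)) <= zeta a) /\
   zeta a <= (1 - 2 `^ (1 - a))^-1.
  apply: sum_nat_lim_bound => [i|m]; first exact: powR_ge0.
  apply: (@le_trans _ _ (\sum_(1 <= k < 2 ^ m) (k%:R `^ (- a)))).
    apply: nondecreasing_sum_nat => [i|]; first exact: powR_ge0.
    by rewrite ltnW// ltn_expl.
  apply: (le_trans (sum_powRN_dyadic _ _ _)); first lra.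
  by apply: sum_geometric_le => //; exact: powR_ge0.
exact: h.
Qed.

End RealPreliminaries.

(** * Bounds for the coefficients and the constants [A_const s] *)

Section ConstantA.
Variable R : realType.

Lemma b_coefE k : (0 < k)%N -> b_coef k = 8 / 2 ^+ k * (1 - 1 / 2 ^+ k) :> R.
Proof.
case: k => // k _; rewrite /b_coef/= powRB ?pnatr_eq0 ?implybT// powR_invn// div1r.
by rewrite !powR_mulrn//; congr (_ / _ * _); ring.
Qed.

Lemma b_coef_bounds k : 0 <= (b_coef k : R) <= 8 / 2 ^+ k.
Proof.
case: k => [|k]; first by rewrite /b_coef expr0; lra.
rewrite b_coefE//; set t := 2 ^+ _.
have t1 : 1 <= t by rewrite exprn_ege1 ?ler1n.
have t0 : 0 < t by rewrite (lt_le_trans _ t1).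
have u0 : 0 <= 1 / t by rewrite divr_ge0// ltW.
have u1 : 1 / t <= 1 by rewrite ler_pdivrMr// mul1r.
have v0 : 0 <= 8 / t by rewrite divr_ge0// ltW.
by apply/andP; split; [apply: mulr_ge0 => //; lra | rewrite -[leRHS]mulr1 ler_wpM2l//; lra].
Qed.

Lemma C_const_ge1 s : 1 <= C_const s :> R.
Proof. by rewrite /C_const le_max lexx. Qed.

Lemma C_const2 : C_const 2 = 1 :> R.
Proof.
rewrite /C_const; apply/max_idPl; rewrite /powR gt_eqF; last by lra.
rewrite expR_le1; apply: mulr_le0_ge0; first by lra.
by apply: ln_ge0; lra.
Qed.

Lemma sqrt_2pi_bounds : 1 / 2 <= (Num.sqrt (2 / pi) : R) <= 1.
Proof.
have p4 := pihalf_02 R; have p2 := pi_ge2 R; have p0 := pi_gt0 R.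
apply/andP; split; last by rewrite -[leRHS]sqrtr1 ler_sqrt// ler_pdivrMr//; lra.
rewrite -[leLHS]ger0_norm -?sqrtr_sqr ?ler_sqrt ?divr_ge0//; try lra.
by rewrite ler_pdivlMr//; lra.
Qed.

Lemma ln_C_ge0 k s : 0 <= ln (C_const s * 2 ^+ (k + 2) * Num.sqrt (2 / pi) : R).
Proof.
have /andP[s0 _] := sqrt_2pi_bounds; have c1 := C_const_ge1 s.
have t1 : 4 <= 2 ^+ (k + 2) :> R.
  rewrite exprD; have : 1 <= 2 ^+ k :> R by rewrite exprn_ege1//; lra.
  by rewrite expr2; nra.
apply: ln_ge0; apply: (@le_trans _ _ (1 * 4 * (1 / 2))); first lra.
by apply: ler_pM; [lra|lra|apply: ler_pM; lra|lra].
Qed.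

(** The dropped logarithm is nonnegative; what is left no longer depends on [s]. *)
Lemma a_coef_ge (k s : nat) : b_coef k * ln (2 * expR 1 * (2 ^+ k.+1 + 1)) <= a_coef k s :> R.
Proof.
have /andP[b0 _] := b_coef_bounds k.
by rewrite /a_coef ler_wpM2l// lerDr divr_ge0// ln_C_ge0.
Qed.

Lemma ln_2e_ge (k : nat) : 1 <= ln (2 * expR 1 * (2 ^+ k.+1 + 1)) :> R.
Proof.
apply: ln_ge_expR; have := expR_gt0 (1 : R).
have : 0 < 2 ^+ k.+1 :> R by rewrite exprn_gt0.
by nra.
Qed.

Lemma expR_ge_horner (q : R) : 0 <= q ->
  1 + q * (1 + q / 2 * (1 + q / 3 * (1 + q / 4 * (1 + q / 5 * (1 + q / 6 *
    (1 + q / 7 * (1 + q / 8))))))) <= expR q.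
Proof.
move=> q0; apply: le_trans (expR_ge_sum _ 9 _ q0).
rewrite -(big_mkord xpredT (fun i => q ^+ i / i`!%:R)).
(* Hides the factorial behind its recursion, so that products replace large unary numerals. *)
have [f [-> f0 fS]] : exists f : nat -> R, [/\ \sum_(0 <= i < 9) q ^+ i / i`!%:R =
    \sum_(0 <= i < 9) q ^+ i / f i, f 0%N = 1 & forall k, f k.+1 = k.+1%:R * f k].
  by exists (fun k => k`!%:R); split=> // k; rewrite factS natrM.
by rewrite !big_nat_recr// big_geq//= !fS f0 !invfM invr1; lra.
Qed.

Lemma ln2_bounds : 0 <= (ln 2 : R) <= 69 / 10 ^+ 2 + 31 / 10 ^+ 4 + 50 / 10 ^+ 6.
Proof.
rewrite ln_ge0 ?ler1n//=; apply: ln_le_expR => //.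
by apply: le_trans (expR_ge_horner _ _); lra.
Qed.

(** The majorants have consecutive ratios [(c + d (k + 1)) / (2 (c + d k))]. The last premise says
    that this is at most [z^2] at [k = K], and it persists because [c + d k] grows; square roots
    then decay with ratio [z]. *)
Lemma sqrt_tail (a : nat -> R) K c d z : 0 <= c -> 0 <= d -> 0 <= z ->
  (forall i, a (K + i)%N <= 8 / 2 ^+ (K + i) * (c + d * (K + i)%:R)) ->
  1 <= 2 * z ^+ 2 -> d <= (2 * z ^+ 2 - 1) * (c + d * K%:R) ->
  forall i, Num.sqrt (a (K + i)%N) <= Num.sqrt (8 / 2 ^+ K * (c + d * K%:R)) * z ^+ i.
Proof.
move=> c0 d0 z0 ha hz hd i.
set w := 8 / 2 ^+ K * (c + d * K%:R).
have w0 : 0 <= w by rewrite mulr_ge0 ?divr_ge0 ?addr_ge0 ?mulr_ge0 ?exprn_ge0.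
rewrite -(@ger0_norm _ (z ^+ i)) ?exprn_ge0// -sqrtr_sqr -sqrtrM//.
apply: ler_wsqrtr; apply: (le_trans (ha i)).
elim: i => [|i IH]; first by rewrite addn0 expr0 expr1n mulr1.
have tp : 0 < 2 ^+ (K + i) :> R by rewrite exprn_gt0.
rewrite addnS -[(K + i).+1%:R]natr1 [2 ^+ _.+1]exprS.
have -> : 8 / (2 * 2 ^+ (K + i)) * (c + d * ((K + i)%:R + 1)) =
   8 / 2 ^+ (K + i) * ((c + d * (K + i)%:R + d) / 2) :> R by field; rewrite gt_eqF.
have -> : w * (z ^+ i.+1) ^+ 2 = w * (z ^+ i) ^+ 2 * z ^+ 2 by rewrite [z ^+ i.+1]exprS; ring.
apply: (@le_trans _ _ (8 / 2 ^+ (K + i) * (c + d * (K + i)%:R) * z ^+ 2)); last first.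
  by rewrite ler_wpM2r ?sqr_ge0.
rewrite -[leRHS]mulrA ler_wpM2l ?divr_ge0 ?(ltW tp)//.
have dK : d * K%:R <= d * (K + i)%:R by rewrite ler_wpM2l// ler_nat leq_addr.
have : (2 * z ^+ 2 - 1) * (c + d * K%:R) <= (2 * z ^+ 2 - 1) * (c + d * (K + i)%:R).
  by rewrite ler_wpM2l ?subr_ge0// lerD2l.
by move: hd; lra.
Qed.

Lemma big_nat_shift (F : nat -> R) K n :
  \sum_(K <= k < K + n) F k = \sum_(0 <= i < n) F (K + i)%N.
Proof.
by rewrite -{1}[K]add0n big_addn addKn; apply: eq_bigr => i _; rewrite addnC.
Qed.

Lemma sum_sqrt_le (a : nat -> R) K c d z q n : 0 <= c -> 0 <= d -> 0 <= z -> z < 1 ->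
  (forall i, a (K + i)%N <= 8 / 2 ^+ (K + i) * (c + d * (K + i)%:R)) ->
  1 <= 2 * z ^+ 2 -> d <= (2 * z ^+ 2 - 1) * (c + d * K%:R) ->
  \sum_(0 <= k < K) Num.sqrt (a k) <= q ->
  \sum_(0 <= k < n) Num.sqrt (a k) <=
    q + Num.sqrt (8 / 2 ^+ K * (c + d * K%:R)) * (1 - z)^-1.
Proof.
move=> c0 d0 z0 z1 ha hz hd hq.
apply: (@le_trans _ _ (\sum_(0 <= k < K + n) Num.sqrt (a k))).
  by apply: nondecreasing_sum_nat => [i|]; [exact: sqrtr_ge0|exact: leq_addl].
rewrite (@big_cat_nat _ _ _ K)//= ?leq_addr// lerD// big_nat_shift.
apply: (@le_trans _ _ (\sum_(0 <= i < n)
    Num.sqrt (8 / 2 ^+ K * (c + d * K%:R)) * z ^+ i)).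
  by apply: ler_sum => i _; exact: sqrt_tail.
rewrite -big_distrr/= ler_wpM2l ?sqrtr_ge0//; exact: sum_geometric_le.
Qed.

(** Factors the argument as [e 2^(k+2) (1 + 2^-(k+1))]; [x] stands for any certified upper bound of
    the logarithm of the last factor. *)
Lemma ln_2e_le k (x : R) : 0 <= x -> 1 + (2 ^+ k.+1)^-1 <= expR x ->
  ln (2 * expR 1 * (2 ^+ k.+1 + 1)) <= 1 + k.+2%:R * ln 2 + x :> R.
Proof.
move=> x0 hx; have e0 := expR_gt0 (1 : R).
have t0 : 0 < 2 ^+ k.+1 :> R by rewrite exprn_gt0.
have -> : 2 * expR 1 * (2 ^+ k.+1 + 1) = expR 1 * 2 ^+ k.+2 * (1 + (2 ^+ k.+1)^-1) :> R.
  by rewrite [2 ^+ k.+2]exprS; field; rewrite gt_eqF.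
have y0 : 0 < 1 + (2 ^+ k.+1)^-1 :> R by rewrite addr_gt0 ?invr_gt0.
rewrite lnM ?posrE ?mulr_gt0 ?exprn_gt0// lnM ?posrE ?exprn_gt0// expRK lnXn//.
rewrite mulr_natl lerD2l.
exact: ln_le_expR.
Qed.

(** A crude bound, meant to show that the series in [A_const s] converges for every [s > 0]. *)
Lemma a_coef_le_general k s : (0 < s)%N ->
  a_coef k s <= 8 / 2 ^+ k * (ln (C_const s) + 6 + 2 * k%:R) :> R.
Proof.
move=> s0; have /andP[b0 b8] := b_coef_bounds k; have /andP[l0 l1] := ln2_bounds.
have c1 := C_const_ge1 s; have c0 : 0 < C_const s :> R by rewrite (lt_le_trans _ c1).
have /andP[q0 q1] := sqrt_2pi_bounds.
have lc := ln_C_ge0 k s; have k0 : 0 <= k%:R :> R by [].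
have h1 : ln (C_const s * 2 ^+ (k + 2) * Num.sqrt (2 / pi)) / s%:R <=
    ln (C_const s) + (k%:R + 2) :> R.
  apply: (@le_trans _ _ (ln (C_const s * 2 ^+ (k + 2) * Num.sqrt (2 / pi)))).
    by rewrite ler_pdivrMr ?ltr0n// ler_peMr// ler1n.
  have p0 : 0 < Num.sqrt (2 / pi) :> R by lra.
  rewrite lnM ?posrE ?mulr_gt0 ?exprn_gt0// lnM ?posrE ?exprn_gt0// lnXn//.
  rewrite -[ln 2 *+ _]mulr_natr natrD.
  by have := ln_le0 q1; nra.
have h2 : ln (2 * expR 1 * (2 ^+ k.+1 + 1)) <= k%:R + 4 :> R.
  apply: le_trans (@ln_2e_le k 1 _ _) _ => //.
    have t1 : (2 ^+ k.+1)^-1 <= 1 :> R by rewrite invf_le1 ?exprn_gt0// exprn_ege1// ler1n.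
    by apply: le_trans (expR_ge1Dx 1); lra.
  by rewrite -addn2 natrD; nra.
rewrite /a_coef; apply: ler_pM => //; last lra.
by rewrite addr_ge0 ?divr_ge0// (le_trans _ (ln_2e_ge k)).
Qed.

Lemma sum_sqrt_a_le_lim s n : (0 < s)%N ->
  \sum_(0 <= k < n) Num.sqrt (a_coef k s) <=
  limn (fun n => \sum_(0 <= k < n) Num.sqrt (a_coef k s)) :> R.
Proof.
move=> s0; set c : R := ln (C_const s) + 6.
have c6 : 6 <= c by rewrite lerDr ln_ge0 ?C_const_ge1.
(* Tail from [K = 0] with ratio 9/10: [2 z^2 - 1 = 0.62], and [2 <= 0.62 c] because [c >= 6]. *)
have hb m : \sum_(0 <= k < m) Num.sqrt (a_coef k s) <=
    0 + Num.sqrt (8 / 2 ^+ 0 * (c + 2 * 0%:R)) * (1 - 9 / 10)^-1 :> R.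
  apply: (@sum_sqrt_le (fun k => a_coef k s)); try lra.
  - by move=> i; rewrite add0n; exact: a_coef_le_general.
  - by rewrite big_geq.
have [h _] := sum_nat_lim_bound _ _ _ _ (fun i => sqrtr_ge0 (a_coef i s)) hb.
exact: h.
Qed.

(** Four terms suffice: 2.8 counted twice, for the indices -1 and 0, then 2.4 and 2.2 add up to more
    than 10, and [2 10^2 = 200]. *)
Lemma A_const_ge s : (0 < s)%N -> 200 <= A_const s :> R.
Proof.
move=> s0; rewrite /A_const.
have := sum_sqrt_a_le_lim s 3 s0; set S := limn _.
rewrite !big_nat_recr//= big_geq// add0r.
have sq (q x : R) : 0 <= q -> q ^+ 2 <= x -> q <= Num.sqrt x.
  by move=> q0 h; rewrite -(ger0_norm q0) -sqrtr_sqr ler_sqrt// (le_trans _ h) ?sqr_ge0.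
(* Here [x] is a lower bound of [ln (2^(k+2) + 2)], the part of the logarithm left after splitting
   off [ln e = 1]. *)
have ge1 (k : nat) (q x : R) : 0 <= q -> 0 <= x -> expR x <= 2 ^+ k.+2 + 2 ->
    q ^+ 2 <= b_coef k * (1 + x) -> q <= Num.sqrt (a_coef k s).
  move=> q0 x0 hx hq; apply: sq => //; apply: le_trans hq _.
  apply: le_trans (a_coef_ge k s); have /andP[b0 _] := b_coef_bounds k.
  rewrite ler_wpM2l//; apply: ln_ge_expR; rewrite expRD.
  by have := expR_gt0 (1 : R); rewrite [2 ^+ k.+2]exprS in hx; nra.
have s1 : 28 / 10 <= Num.sqrt (a_coef 0 s) :> R.
  apply: (@ge1 0%N _ (17 / 10)); rewrite ?/b_coef/=; try lra.
  by apply: (@expR_le_pow _ 31); lra.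
have s2 : 24 / 10 <= Num.sqrt (a_coef 1 s) :> R.
  apply: (@ge1 1%N _ 2); rewrite ?b_coefE//; try lra.
  by apply: (@expR_le_pow _ 31); lra.
have s3 : 22 / 10 <= Num.sqrt (a_coef 2 s) :> R.
  apply: (@ge1 2%N _ (24 / 10)); rewrite ?b_coefE//; try lra.
  by apply: (@expR_le_pow _ 31); lra.
move=> hS; have : 10 <= Num.sqrt (a_coef 0 s) + S by lra.
by nra.
Qed.

(** * Numerical upper bound for [A_const 2] *)

(** For [s = 2] the bracket is at most [1 + 3/2 (k + 2) ln 2 - 0.1127 + x], the negative constant
    being half the bound for [ln (sqrt (2 / pi))]. Inserting [ln 2 <= 0.69315] gives 2.96675, and
    the slope 1.039725 is rounded up to 1.03973. *)
Lemma a_coef2_le k (x : R) : 0 <= x -> 1 + (2 ^+ k.+1)^-1 <= expR x ->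
  a_coef k 2 <= b_coef k * (296 / 10 ^+ 2 + 67 / 10 ^+ 4 + 50 / 10 ^+ 6 + x +
    (103 / 10 ^+ 2 + 97 / 10 ^+ 4 + 30 / 10 ^+ 6) * k%:R) :> R.
Proof.
move=> x0 hx; have /andP[b0 _] := b_coef_bounds k; have /andP[l0 l1] := ln2_bounds.
have k0 : 0 <= k%:R :> R by [].
have p0 := pi_gt0 R.
have lpi : ln (Num.sqrt (2 / pi)) <= - (2254 / 10 ^+ 4) :> R.
  rewrite -powR12_sqrt ?divr_ge0 ?(ltW p0)// ln_powR ln_div ?posrE//.
  (* This amounts to [pi / 2 >= exp 0.4508], for which 1.57 lies in between. *)
  suff : ln 2 + 4508 / 10 ^+ 4 <= ln pi :> R by lra.
  apply: ln_ge_expR; rewrite expRD lnK ?posrE//.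
  have : expR (4508 / 10 ^+ 4) <= 157 / 100 :> R.
    by apply: (@expR_le_pow _ 511); lra.
  by have := pi_gt_314 R; lra.
rewrite /a_coef ler_wpM2l// C_const2 mul1r.
have /andP[q0 _] := sqrt_2pi_bounds.
rewrite lnM ?posrE ?exprn_gt0//; last lra.
rewrite lnXn// -[ln 2 *+ _]mulr_natr natrD.
have := ln_2e_le k x x0 hx; rewrite -[k.+2]addn2 natrD.
have := ler_wpM2r k0 l1; move: lpi l1 k0; clear.
set l := ln 2; set u := ln (2 * _ * _); set v := ln (Num.sqrt _); set t := k%:R => *.
by lra.
Qed.

Lemma sqrt_a_coef2_le k (x q : R) : 0 <= x -> 0 <= q -> 1 + (2 ^+ k.+1)^-1 <= expR x ->
  b_coef k * (296 / 10 ^+ 2 + 67 / 10 ^+ 4 + 50 / 10 ^+ 6 + x +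
    (103 / 10 ^+ 2 + 97 / 10 ^+ 4 + 30 / 10 ^+ 6) * k%:R) <= q ^+ 2 ->
  Num.sqrt (a_coef k 2) <= q :> R.
Proof.
move=> x0 q0 hx h; rewrite -(ger0_norm q0) -sqrtr_sqr; apply: ler_wsqrtr.
exact: le_trans (a_coef2_le _ _ x0 hx) h.
Qed.

(** From index 12 on the correction [x] can be frozen at [2^-13], and 2.96675 is rounded up to
    2.9669 to absorb it. *)
Lemma a_coef2_tail i : a_coef (12 + i) 2 <= 8 / 2 ^+ (12 + i) *
  (296 / 10 ^+ 2 + 69 / 10 ^+ 4 + (103 / 10 ^+ 2 + 97 / 10 ^+ 4 + 30 / 10 ^+ 6) * (12 + i)%:R) :> R.
Proof.
have [b0 b8] := andP (b_coef_bounds (12 + i)).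
have h : 1 + (2 ^+ (12 + i).+1)^-1 <= expR (1 / 2 ^+ 13) :> R.
  apply: le_trans (expR_ge1Dx _); rewrite lerD2l div1r lef_pV2 ?posrE ?exprn_gt0//.
  by rewrite ler_weXn2l ?ler1n.
apply: le_trans (a_coef2_le _ _ _ h) _; first lra.
have n0 : 0 <= (12 + i)%:R :> R by [].
move: n0 b0 b8; clear h; set t := _%:R; set u := 8 / _; set b := b_coef _ => t0 b0 b8.
by apply: ler_pM => //; lra.
Qed.

(* Pulls out the factor [2 ^- 12] to keep the numbers small. *)
Lemma sqrt_a_coef2_tail i (q : R) : 0 <= q ->
  8 / 2 ^+ i * (296 / 10 ^+ 2 + 69 / 10 ^+ 4 +
    (103 / 10 ^+ 2 + 97 / 10 ^+ 4 + 30 / 10 ^+ 6) * (12 + i)%:R) <= q ^+ 2 ->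
  Num.sqrt (a_coef (12 + i) 2) <= q / 64 :> R.
Proof.
move=> q0 h; have q1 : 0 <= q / 64 by lra.
rewrite -(ger0_norm q1) -sqrtr_sqr; apply: ler_wsqrtr.
apply: le_trans (a_coef2_tail i) _; rewrite (_ : 8 / 2 ^+ (12 + i) = 8 / 2 ^+ i * (2 ^+ 12)^-1).
  rewrite mulrAC exprMn (_ : (64^-1) ^+ 2 = (2 ^+ 12)^-1 :> R); last by clear; lra.
  by rewrite ler_wpM2r ?invr_ge0 ?exprn_ge0.
by rewrite exprD invfM; ring.
Qed.

Lemma sum_sqrt_a_coef2_step n (u q v : R) :
  \sum_(0 <= k < n) Num.sqrt (a_coef k 2) <= u -> Num.sqrt (a_coef n 2) <= q ->
  u + q <= v -> \sum_(0 <= k < n.+1) Num.sqrt (a_coef k 2) <= v.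
Proof.
by move=> h1 h2; apply: le_trans; rewrite big_nat_recr//=; exact: lerD.
Qed.

(** Peels off terms from the last one down, each time giving a bound for the shorter sum and one for
    the removed term. The indices 12 to 23 use the tail estimate, 5 to 11 the bound
    [exp x >= 1 + x], and 0 to 4 the Taylor polynomial of degree 8. *)
Lemma sum_sqrt_a_coef2_le : \sum_(0 <= k < 24) Num.sqrt (a_coef k 2) <=
  18 + 50 / 10 ^+ 2 + 81 / 10 ^+ 4 + 85 / 10 ^+ 6 :> R.
Proof.
apply: (@sum_sqrt_a_coef2_step 23 (18 + 50 / 10 ^+ 2 + 31 / 10 ^+ 4 + 20 / 10 ^+ 6)
  ((32 / 10 ^+ 2 + 41 / 10 ^+ 4) / 64)); last by lra.
  2: by apply: (sqrt_a_coef2_tail 11); lra.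
apply: (@sum_sqrt_a_coef2_step 22 (18 + 49 / 10 ^+ 2 + 60 / 10 ^+ 4 + 98 / 10 ^+ 6)
  ((44 / 10 ^+ 2 + 94 / 10 ^+ 4) / 64)); last by lra.
  2: by apply: (sqrt_a_coef2_tail 10); lra.
apply: (@sum_sqrt_a_coef2_step 21 (18 + 48 / 10 ^+ 2 + 63 / 10 ^+ 4 + 69 / 10 ^+ 6)
  ((62 / 10 ^+ 2 + 26 / 10 ^+ 4) / 64)); last by lra.
  2: by apply: (sqrt_a_coef2_tail 9); lra.
apply: (@sum_sqrt_a_coef2_step 20 (18 + 47 / 10 ^+ 2 + 29 / 10 ^+ 4 + 3 / 10 ^+ 6)
  ((86 / 10 ^+ 2 + 18 / 10 ^+ 4) / 64)); last by lra.
  2: by apply: (sqrt_a_coef2_tail 8); lra.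
apply: (@sum_sqrt_a_coef2_step 19 (18 + 45 / 10 ^+ 2 + 42 / 10 ^+ 4 + 82 / 10 ^+ 6)
  ((1 + 19 / 10 ^+ 2 + 17 / 10 ^+ 4) / 64)); last by lra.
  2: by apply: (sqrt_a_coef2_tail 7); lra.
apply: (@sum_sqrt_a_coef2_step 18 (18 + 42 / 10 ^+ 2 + 85 / 10 ^+ 4 + 58 / 10 ^+ 6)
  ((1 + 64 / 10 ^+ 2 + 63 / 10 ^+ 4) / 64)); last by lra.
  2: by apply: (sqrt_a_coef2_tail 6); lra.
apply: (@sum_sqrt_a_coef2_step 17 (18 + 39 / 10 ^+ 2 + 30 / 10 ^+ 4 + 62 / 10 ^+ 6)
  ((2 + 27 / 10 ^+ 2 + 17 / 10 ^+ 4) / 64)); last by lra.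
  2: by apply: (sqrt_a_coef2_tail 5); lra.
apply: (@sum_sqrt_a_coef2_step 16 (18 + 34 / 10 ^+ 2 + 41 / 10 ^+ 4 + 43 / 10 ^+ 6)
  ((3 + 13 / 10 ^+ 2 + 8 / 10 ^+ 4) / 64)); last by lra.
  2: by apply: (sqrt_a_coef2_tail 4); lra.
apply: (@sum_sqrt_a_coef2_step 15 (18 + 27 / 10 ^+ 2 + 68 / 10 ^+ 4 + 22 / 10 ^+ 6)
  ((4 + 30 / 10 ^+ 2 + 85 / 10 ^+ 4) / 64)); last by lra.
  2: by apply: (sqrt_a_coef2_tail 3); lra.
apply: (@sum_sqrt_a_coef2_step 14 (18 + 18 / 10 ^+ 2 + 43 / 10 ^+ 4 + 21 / 10 ^+ 6)
  ((5 + 92 / 10 ^+ 2 + 0 / 10 ^+ 4) / 64)); last by lra.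
  2: by apply: (sqrt_a_coef2_tail 2); lra.
apply: (@sum_sqrt_a_coef2_step 13 (18 + 5 / 10 ^+ 2 + 74 / 10 ^+ 4 + 45 / 10 ^+ 6)
  ((8 + 12 / 10 ^+ 2 + 0 / 10 ^+ 4) / 64)); last by lra.
  2: by apply: (sqrt_a_coef2_tail 1); lra.
apply: (@sum_sqrt_a_coef2_step 12 (17 + 88 / 10 ^+ 2 + 37 / 10 ^+ 4 + 68 / 10 ^+ 6)
  ((11 + 11 / 10 ^+ 2 + 53 / 10 ^+ 4) / 64)); last by lra.
  2: by apply: (sqrt_a_coef2_tail 0); lra.
apply: (@sum_sqrt_a_coef2_step 11 (17 + 64 / 10 ^+ 2 + 66 / 10 ^+ 4 + 20 / 10 ^+ 6)
  (23 / 10 ^+ 2 + 71 / 10 ^+ 4 + 47 / 10 ^+ 6)); last by lra.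
  2: apply: (@sqrt_a_coef2_le 11 ((2 ^+ 12)^-1)); [lra|lra|
    exact: expR_ge1Dx|rewrite b_coefE//; lra].
apply: (@sum_sqrt_a_coef2_step 10 (17 + 32 / 10 ^+ 2 + 36 / 10 ^+ 4 + 50 / 10 ^+ 6)
  (32 / 10 ^+ 2 + 29 / 10 ^+ 4 + 69 / 10 ^+ 6)); last by lra.
  2: apply: (@sqrt_a_coef2_le 10 ((2 ^+ 11)^-1)); [lra|lra|
    exact: expR_ge1Dx|rewrite b_coefE//; lra].
apply: (@sum_sqrt_a_coef2_step 9 (16 + 88 / 10 ^+ 2 + 52 / 10 ^+ 4 + 35 / 10 ^+ 6)
  (43 / 10 ^+ 2 + 84 / 10 ^+ 4 + 14 / 10 ^+ 6)); last by lra.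
  2: apply: (@sqrt_a_coef2_le 9 ((2 ^+ 10)^-1)); [lra|lra|
    exact: expR_ge1Dx|rewrite b_coefE//; lra].
apply: (@sum_sqrt_a_coef2_step 8 (16 + 29 / 10 ^+ 2 + 25 / 10 ^+ 4 + 5 / 10 ^+ 6)
  (59 / 10 ^+ 2 + 27 / 10 ^+ 4 + 29 / 10 ^+ 6)); last by lra.
  2: apply: (@sqrt_a_coef2_le 8 ((2 ^+ 9)^-1)); [lra|lra|
    exact: expR_ge1Dx|rewrite b_coefE//; lra].
apply: (@sum_sqrt_a_coef2_step 7 (15 + 49 / 10 ^+ 2 + 52 / 10 ^+ 4 + 94 / 10 ^+ 6)
  (79 / 10 ^+ 2 + 72 / 10 ^+ 4 + 10 / 10 ^+ 6)); last by lra.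
  2: apply: (@sqrt_a_coef2_le 7 ((2 ^+ 8)^-1)); [lra|lra|
    exact: expR_ge1Dx|rewrite b_coefE//; lra].
apply: (@sum_sqrt_a_coef2_step 6 (14 + 43 / 10 ^+ 2 + 5 / 10 ^+ 4 + 75 / 10 ^+ 6)
  (1 + 6 / 10 ^+ 2 + 47 / 10 ^+ 4 + 18 / 10 ^+ 6)); last by lra.
  2: apply: (@sqrt_a_coef2_le 6 ((2 ^+ 7)^-1)); [lra|lra|
    exact: expR_ge1Dx|rewrite b_coefE//; lra].
apply: (@sum_sqrt_a_coef2_step 5 (13 + 2 / 10 ^+ 2 + 29 / 10 ^+ 4 + 72 / 10 ^+ 6)
  (1 + 40 / 10 ^+ 2 + 76 / 10 ^+ 4 + 2 / 10 ^+ 6)); last by lra.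
  2: apply: (@sqrt_a_coef2_le 5 ((2 ^+ 6)^-1)); [lra|lra|
    exact: expR_ge1Dx|rewrite b_coefE//; lra].
apply: (@sum_sqrt_a_coef2_step 4 (11 + 19 / 10 ^+ 2 + 14 / 10 ^+ 4 + 19 / 10 ^+ 6)
  (1 + 83 / 10 ^+ 2 + 15 / 10 ^+ 4 + 52 / 10 ^+ 6)); last by lra.
  2: apply: (@sqrt_a_coef2_le 4 (3 / 10 ^+ 2 + 7 / 10 ^+ 4 + 72 / 10 ^+ 6)); [lra|lra|
    by apply: le_trans (expR_ge_horner _ _); lra|rewrite b_coefE//; lra].
apply: (@sum_sqrt_a_coef2_step 3 (8 + 87 / 10 ^+ 2 + 23 / 10 ^+ 4 + 13 / 10 ^+ 6)
  (2 + 31 / 10 ^+ 2 + 91 / 10 ^+ 4 + 5 / 10 ^+ 6)); last by lra.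
  2: apply: (@sqrt_a_coef2_le 3 (6 / 10 ^+ 2 + 6 / 10 ^+ 4 + 25 / 10 ^+ 6)); [lra|lra|
    by apply: le_trans (expR_ge_horner _ _); lra|rewrite b_coefE//; lra].
apply: (@sum_sqrt_a_coef2_step 2 (6 + 8 / 10 ^+ 2 + 91 / 10 ^+ 4 + 49 / 10 ^+ 6)
  (2 + 78 / 10 ^+ 2 + 31 / 10 ^+ 4 + 63 / 10 ^+ 6)); last by lra.
  2: apply: (@sqrt_a_coef2_le 2 (11 / 10 ^+ 2 + 77 / 10 ^+ 4 + 84 / 10 ^+ 6)); [lra|lra|
    by apply: le_trans (expR_ge_horner _ _); lra|rewrite b_coefE//; lra].
apply: (@sum_sqrt_a_coef2_step 1 (3 + 18 / 10 ^+ 2 + 6 / 10 ^+ 4 + 69 / 10 ^+ 6)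
  (2 + 90 / 10 ^+ 2 + 84 / 10 ^+ 4 + 79 / 10 ^+ 6)); last by lra.
  2: apply: (@sqrt_a_coef2_le 1 (22 / 10 ^+ 2 + 31 / 10 ^+ 4 + 44 / 10 ^+ 6)); [lra|lra|
    by apply: le_trans (expR_ge_horner _ _); lra|rewrite b_coefE//; lra].
apply: (@sum_sqrt_a_coef2_step 0 (0)
  (3 + 18 / 10 ^+ 2 + 6 / 10 ^+ 4 + 68 / 10 ^+ 6)); last by lra.
  2: apply: (@sqrt_a_coef2_le 0 (40 / 10 ^+ 2 + 54 / 10 ^+ 4 + 66 / 10 ^+ 6)); [lra|lra|
    by apply: le_trans (expR_ge_horner _ _); lra|rewrite /b_coef/=; lra].
by rewrite big_geq.
Qed.

Lemma A_const2_le : A_const 2 <= 942 :> R.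
Proof.
(* The ratio 0.7202 is just large enough for [K = 24]: [2 z^2 - 1] is about 0.0374, and its product
   with [c + 24 d], about 27.92, slightly exceeds [d = 1.03973]. *)
have hb n : \sum_(0 <= k < n) Num.sqrt (a_coef k 2) <= 18 + 50 / 10 ^+ 2 + 81 / 10 ^+ 4 + 85 / 10 ^+ 6 +
    Num.sqrt (8 / 2 ^+ 24 * (296 / 10 ^+ 2 + 69 / 10 ^+ 4 +
      (103 / 10 ^+ 2 + 97 / 10 ^+ 4 + 30 / 10 ^+ 6) * 24%:R)) * (1 - 7202 / 10 ^+ 4)^-1 :> R.
  apply: (@sum_sqrt_le (fun k => a_coef k 2)); try lra.
  - by move=> i; exact: (a_coef2_tail (12 + i)).
  - exact: sum_sqrt_a_coef2_le.
have [_ hS] := sum_nat_lim_bound _ _ _ _ (fun i => sqrtr_ge0 (a_coef i 2)) hb.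
have h0 : Num.sqrt (a_coef 0 2) <= 3 + 18 / 10 ^+ 2 + 6 / 10 ^+ 4 + 68 / 10 ^+ 6 :> R.
  apply: (@sqrt_a_coef2_le 0 (40 / 10 ^+ 2 + 54 / 10 ^+ 4 + 66 / 10 ^+ 6)); [lra|lra| |rewrite /b_coef/=; lra].
  by apply: le_trans (expR_ge_horner _ _); lra.
have hg : Num.sqrt (8 / 2 ^+ 24 * (296 / 10 ^+ 2 + 69 / 10 ^+ 4 +
      (103 / 10 ^+ 2 + 97 / 10 ^+ 4 + 30 / 10 ^+ 6) * 24%:R)) <= (23 / 10 ^+ 2 + 36 / 10 ^+ 4) / 64 :> R.
  have g0 : 0 <= (23 / 10 ^+ 2 + 36 / 10 ^+ 4) / 64 :> R by lra.
  by rewrite -(ger0_norm g0) -sqrtr_sqr; apply: ler_wsqrtr; lra.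
have S0 : 0 <= Num.sqrt (a_coef 0 2) + limn (fun n => \sum_(0 <= k < n) Num.sqrt (a_coef k 2)) :> R.
  rewrite addr_ge0 ?sqrtr_ge0//; apply: le_trans (sum_sqrt_a_le_lim 2 0 _) => //.
  by rewrite big_geq.
rewrite /A_const; move: hS h0 hg S0; set L := limn _; set g := Num.sqrt (8 / _ * _).
set y := Num.sqrt _ => hS h0 hg S0.
have v : (1 - 7202 / 10 ^+ 4)^-1 = 5000 / 1399 :> R.
  clear; rewrite -[RHS]invrK; congr (_^-1); rewrite invf_div; lra.
rewrite {}v in hS.
(* Repeated first term 3.180668, 24 terms 18.508185, tail about 0.0130: below 21.7025, and twice the
   square of 21.7025 is about 941.997. *)
have : y + L <= 21 + 70 / 10 ^+ 2 + 25 / 10 ^+ 4 by lra.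
move: S0; set w := y + L => S0 hw.
have : w ^+ 2 <= (21 + 70 / 10 ^+ 2 + 25 / 10 ^+ 4) ^+ 2 by rewrite lerXn2r ?nnegrE//; lra.
by lra.
Qed.

End ConstantA.

(** * Grids of box corners and bracketing of boxes *)

Section Grid.
Variable R : realType.

(** Volume is 1-Lipschitz for the sum distance on the cube; the induction also carries that both
    products stay ordered in [[0, 1]]. *)
Lemma prod_sub_le_sum (I : Type) (r : seq I) (x z : I -> R) :
  (forall i, 0 <= x i /\ x i <= z i /\ z i <= 1) ->
  \prod_(i <- r) z i - \prod_(i <- r) x i <= \sum_(i <- r) (z i - x i).
Proof.
move=> h; pose P (A B C : R) := [/\ 0 <= B, B <= A, A <= 1 & A - B <= C].
suff [] : P (\prod_(i <- r) z i) (\prod_(i <- r) x i) (\sum_(i <- r) (z i - x i)) by [].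
elim/big_rec3: _ => [|i A B C _ [B0 BA A1 ABC]]; first by rewrite /P; split; lra.
have [x0 [xz z1]] := h i; rewrite /P; split; nra.
Qed.

Lemma prod_le_expR (I : Type) (r : seq I) (y : I -> R) : (forall i, 0 <= y i) ->
  \prod_(i <- r) y i <= expR (- \sum_(i <- r) (1 - y i)).
Proof.
move=> y0; rewrite -sumrN expR_sum; apply: ler_prod => i _; rewrite y0/=.
by apply: le_trans (expR_ge1Dx _); lra.
Qed.

(** Pulls a lattice point lying beyond the simplex back to its boundary, as needed for upper
    brackets. *)
Lemma truncate_sum (I : finType) (f : I -> nat) n : (n <= \sum_i f i)%N ->
  exists g : I -> nat, (forall i, g i <= f i)%N /\ (\sum_i g i = n)%N.
Proof.
elim: n => [|n IH] hn; first by exists (fun=> 0%N); split => //; rewrite big1.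
have [g [gf gn]] := IH (ltnW hn).
have [i hi] : exists i, (g i < f i)%N.
  apply/existsP; rewrite -[[exists _, _]]negbK negb_exists; apply/negP => /forallP h.
  move: hn; rewrite -gn ltnNge; apply/negP/negPn; apply: leq_sum => j _.
  by rewrite leqNgt.
exists (fun j => if j == i then (g i).+1 else g j); split => [j|].
  by case: eqP => [->|].
rewrite (bigD1 i)//= eqxx -gn [in RHS](bigD1 i)//= addSn; congr (_ + _).+1.
by apply: eq_bigr => j /negPf ->.
Qed.

(* Weighing [f] by [x ^ (sum f)] with [x = m / (m + 1)] and summing freely over
   the coordinates gives the bound. *)
Lemma card_simplex s m : (0 < m)%N ->
  (#|[set f : {ffun 'I_s -> 'I_(s * m).+1} | (\sum_i f i <= s * m)%N]%SET|)%:R <=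
  (expR 1 * m.+1%:R) ^+ s :> R.
Proof.
move=> m0; set G := [set f | _]%SET; pose x : R := m%:R / m.+1%:R.
have M0 : 0 < m.+1%:R :> R by rewrite ltr0n.
have mp : 0 < m%:R :> R by rewrite ltr0n.
have x0 : 0 < x by rewrite divr_gt0.
have x1 : x <= 1 by rewrite ler_pdivrMr// mul1r ler_nat.
have e1 : 1 - x = m.+1%:R^-1.
  by rewrite /x -{1}(divff (lt0r_neq0 M0)) -mulrBl -natr1 addrC addKr mul1r.
have h1 : (#|G|)%:R * x ^+ (s * m) <= m.+1%:R ^+ s.
  apply: (@le_trans _ _ (\sum_(f : {ffun 'I_s -> 'I_(s * m).+1}) \prod_i x ^+ f i)).
    rewrite -sum1_card natr_sum big_distrl/= (big_mkcond (mem G))/=.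
    apply: ler_sum => f _; case: ifPn => [|_]; last by rewrite prodr_ge0// => i _; rewrite exprn_ge0 ?ltW.
    rewrite inE => hf; rewrite mul1r -expr_sum.
    by apply: ler_wiXn2l => //; exact: ltW.
  rewrite -(bigA_distr_bigA (fun (_ : 'I_s) (j : 'I_(s * m).+1) => x ^+ j))/= prodr_const card_ord lerXn2r ?nnegrE ?ler0n//.
    by rewrite sumr_ge0// => i _; rewrite exprn_ge0 ?ltW.
  rewrite -(big_mkord xpredT (fun j => x ^+ j)).
  apply: (le_trans (sum_geometric_le _ _ _ (ltW x0) _)).
    by rewrite /x ltr_pdivrMr// mul1r ltr_nat.
  by rewrite e1 invrK.
(* Indeed [x^-m = (1 + 1/m)^m <= e], so removing the weight [x^(s m)] costs a factor [e^s]. *)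
have h2 : 1 <= expR 1 * x ^+ m.
  have : x^-1 ^+ m <= expR 1.
    have -> : x^-1 = 1 + m%:R^-1 by rewrite /x invf_div -natr1 mulrDl divff ?lt0r_neq0// mul1r.
    apply: (@le_trans _ _ (expR m%:R^-1 ^+ m)).
      by rewrite lerXn2r ?nnegrE ?expR_ge0 ?addr_ge0 ?invr_ge0 ?expR_ge1Dx.
    by rewrite -expRM_natl mulfV ?lt0r_neq0.
  by rewrite -ler_pdivrMr ?exprn_gt0// div1r -exprVn.
have h3 : 1 <= (expR 1 * x ^+ m) ^+ s by rewrite exprn_ege1.
rewrite exprMn; apply: (@le_trans _ _ ((#|G|)%:R * (expR 1 * x ^+ m) ^+ s)).
  by rewrite ler_peMr.
rewrite exprMn mulrCA ler_wpM2l ?exprn_ge0 ?expR_ge0//.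
by rewrite -exprM [(m * s)%N]mulnC.
Qed.

(* Level [k] of the grid has resolution [64 ^- k].  A lattice point [f] stands for
   the point with coordinates [1 - f i * 64 ^- k / s]; only lattice points with
   [sum f <= s * gm k] are kept, since by [prod y <= exp (- sum (1 - y i))] all
   others bound boxes of volume below the resolution. *)
Definition gdelta (k : nat) : R := (64 ^+ k)^-1.
Definition gm (k : nat) : nat := (512 ^ k).-1.
Definition grid_dom (s k : nat) := {ffun 'I_s -> 'I_(s * gm k).+1}.
Definition grid (s k : nat) : {set grid_dom s k} :=
  [set f : grid_dom s k | (\sum_i f i <= s * gm k)%N].
Definition npoint (s k : nat) (f : 'I_s -> nat) (i : 'I_s) : R :=
  Num.max 0 (1 - (f i)%:R * (gdelta k / s%:R)).
Definition gpoint (s k : nat) (f : grid_dom s k) : 'I_s -> R :=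
  npoint s k (fun i => f i).
Definition vol (s : nat) (y : 'I_s -> R) : R := \prod_i y i.
Definition inbox (s : nat) (y x : 'I_s -> R) : bool :=
  [forall i, (0 <= x i) && (x i < y i)].
(** Containment of boxes instead of an order on corners: an empty box counts as a lower bracket even
    if some coordinates of its corner exceed those of [y]. The volume inequality is therefore
    recorded separately. *)
Definition subbox (s : nat) (p y : 'I_s -> R) : Prop :=
  (forall x, inbox s p x -> inbox s y x) /\ vol s p <= vol s y.
Definition in_cube (s : nat) (y : 'I_s -> R) : Prop := forall i, 0 <= y i <= 1.

Lemma gdelta_gt0 k : 0 < gdelta k.
Proof. by rewrite /gdelta invr_gt0 exprn_gt0. Qed.

Lemma gm_gt0 k : (0 < k)%N -> (0 < gm k)%N.
Proof.
by case: k => // k _; rewrite /gm -ltnS prednK ?expn_gt0// -{1}(expn0 512) ltn_exp2l.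
Qed.

Lemma gmS k : (gm k).+1%:R = 512 ^+ k :> R.
Proof. by rewrite /gm prednK ?expn_gt0// natrX. Qed.

Lemma card_grid s k : (0 < k)%N -> (#|grid s k|)%:R <= (expR 1 * 512 ^+ k) ^+ s :> R.
Proof. move=> k0; have := card_simplex s (gm k) (gm_gt0 k k0); by rewrite gmS. Qed.

(** With [512 = 8 64] the exponent is [8^k - 2 / 64^k], which is at least [7 k], while
    [e^7 >= 2^7 >= 64]. The [- 1] leaves room for one rounding unit per coordinate. *)
Lemma expR_gm_le k : (0 < k)%N -> expR (- (gdelta k * ((gm k)%:R - 1))) <= gdelta k.
Proof.
move=> k0; rewrite expRN /gdelta lef_pV2 ?posrE ?expR_gt0 ?exprn_gt0//.
have -> : (gm k)%:R = 512 ^+ k - 1 :> R by rewrite -gmS -natr1 addrK.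
have -> : 512 = 8 * 64 :> R by lra.
rewrite exprMn; set u := 64 ^+ k; set v := 8 ^+ k.
have u2 : 2 <= u.
  apply: (@le_trans _ _ (64 ^+ 1)); first lra.
  by apply: ler_weXn2l => //; lra.
have -> : u^-1 * (v * u - 1 - 1) = v - 2 / u by field; lra.
have h7 : k%:R * 7 + 1 <= v.
  rewrite /v; clear; elim: k => [|k IH]; first by rewrite expr0; lra.
  by rewrite exprS -natr1; have : 0 <= k%:R :> R by []; lra.
have u1 : 2 / u <= 1 by rewrite ler_pdivrMr; lra.
apply: (@le_trans _ _ (expR (k%:R * 7))); last by rewrite ler_expR; lra.
rewrite expRM_natl /u lerXn2r ?nnegrE ?expR_ge0//.
have -> : 7 = 7%:R * 1 :> R by rewrite mulr1.
rewrite expRM_natl; apply: (@le_trans _ _ (2 ^+ 7)); first lra.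
by rewrite lerXn2r ?nnegrE ?expR_ge0//; apply: le_trans (expR_ge1Dx _); lra.
Qed.

Lemma npoint_cube s k f : in_cube s (npoint s k f).
Proof.
move=> i; rewrite /npoint le_max lexx/= ge_max ler01/=.
by rewrite gerBl mulr_ge0// divr_ge0// ltW// gdelta_gt0.
Qed.

Lemma grid_of_npoint s k f : (\sum_i f i <= s * gm k)%N ->
  exists2 g, g \in grid s k & npoint s k f = gpoint s k g.
Proof.
move=> hf; have fi i : (f i < (s * gm k).+1)%N.
  by rewrite ltnS (leq_trans _ hf)// (bigD1 i)//= leq_addr.
exists [ffun i => inord (f i)].
  by rewrite inE (eq_bigr f)// => i _; rewrite ffunE inordK.
by apply/funext => i; rewrite /gpoint /npoint ffunE inordK.
Qed.

(** Rounding each [1 - y i] to a multiple of [gdelta k / s], up for the lower bracket and down for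
    the upper one, changes the volume by at most [gdelta k]. If the rounded point leaves the
    simplex, the larger of the two boxes compared has volume at most [gdelta k] anyway, so an empty
    box or a truncated point will do. *)
Lemma grid_bracket s k y : (0 < s)%N -> (0 < k)%N -> in_cube s y ->
  (exists2 f, f \in grid s k &
     subbox s (gpoint s k f) y /\ vol s y - vol s (gpoint s k f) <= gdelta k) /\
  (exists2 g, g \in grid s k &
     subbox s y (gpoint s k g) /\ vol s (gpoint s k g) - vol s y <= gdelta k).
Proof.
move=> s0 k0 yc; have d0 := gdelta_gt0 k; set e := gdelta k / s%:R.
have sp : 0 < s%:R :> R by rewrite ltr0n.
have e0 : 0 < e by rewrite divr_gt0.
have ge0 i : 0 <= y i by have /andP[] := yc i.
have se : \sum_(i < s) e = gdelta k.
  by rewrite sumr_const card_ord -mulr_natr /e divfK// gt_eqF.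
pose f i := Num.truncn ((1 - y i) / e).
have f1 i : (f i)%:R * e <= 1 - y i.
  have /andP[h _] : (f i)%:R <= (1 - y i) / e < (f i).+1%:R.
    by rewrite /f truncn_itv// divr_ge0 ?(ltW e0)// subr_ge0; have /andP[] := yc i.
  by rewrite -ler_pdivlMr.
have f2 i : 1 - y i < ((f i).+1)%:R * e.
  have /andP[_ h] : (f i)%:R <= (1 - y i) / e < (f i).+1%:R.
    by rewrite /f truncn_itv// divr_ge0 ?(ltW e0)// subr_ge0; have /andP[] := yc i.
  by rewrite -ltr_pdivrMr.
(* The slack [+ s] is needed because [sum (f i).+1] beyond [s * gm k] only bounds [sum f] up to
   [s]. *)
have big_vol (z : 'I_s -> R) (n : nat) : (forall i, 0 <= z i) -> (s * gm k <= n + s)%N ->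
    n%:R * e <= \sum_i (1 - z i) -> vol s z <= gdelta k.
  move=> z0 hn hz; apply: le_trans (prod_le_expR _ _ _ z0) _.
  apply: le_trans (expR_gm_le k k0); rewrite ler_expR lerN2 (le_trans _ hz)//.
  rewrite /e mulrCA ler_wpM2l ?(ltW d0)//.
  have : (s * gm k)%:R <= n%:R + s%:R :> R by rewrite -natrD ler_nat.
  by rewrite ler_pdivlMr// natrM; lra.
have sumf g : (forall i, (g i <= f i)%N) -> (\sum_i g i)%:R * e <= \sum_i (1 - y i).
  move=> gf; rewrite natr_sum big_distrl/=; apply: ler_sum => i _.
  by apply: le_trans (f1 i); rewrite ler_wpM2r ?(ltW e0)// ler_nat.
have sub_of (p z : 'I_s -> R) : (forall i, 0 <= p i) -> (forall i, p i <= z i) -> subbox s p z.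
  move=> p0 pz; split=> [x /forallP h|].
    by apply/forallP => i; have /andP[-> /lt_le_trans] := h i; apply.
  by apply: ler_prod => i _; rewrite p0 pz.
split.
  have [hs|hs] := leqP (\sum_i (f i).+1) (s * gm k).
    have [g gG gE] := grid_of_npoint s k (fun i => (f i).+1) hs.
    exists g => //; rewrite -gE; set p := npoint _ _ _.
    have py i : p i <= y i.
      by rewrite /p /npoint ge_max ge0/= -/e; have := f2 i; lra.
    have p0 i : 0 <= p i by have /andP[] := npoint_cube s k (fun i => (f i).+1) i.
    split; first exact: sub_of.
    apply: le_trans (prod_sub_le_sum _ _ p y _) _ => [i|].
      by split; [exact: p0|split; [exact: py|have /andP[] := yc i]].
    rewrite -se; apply: ler_sum => i _.
    have : 1 - (f i).+1%:R * e <= p i by rewrite /p /npoint le_max lexx orbT.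
    by rewrite -natr1 mulrDl mul1r; have := f1 i; lra.
  have hd : (64 ^ k <= gm k)%N.
    rewrite /gm -ltnS prednK ?expn_gt0// (_ : 512 = 8 * 64)%N// expnMn.
    by rewrite -{1}[(64 ^ k)%N]mul1n ltn_pmul2r ?expn_gt0// -{1}(expn0 8) ltn_exp2l.
  (* The value [s 64^k] in one coordinate makes that coordinate of the corner 0, hence the box
     empty; [hd] keeps this point inside the simplex. *)
  have [|g gG gE] := grid_of_npoint s k (fun i => if i == Ordinal s0 then (s * 64 ^ k)%N else 0%N).
    by rewrite (bigD1 (Ordinal s0))//= ?eqxx big1 ?addn0 ?leq_mul2l ?hd ?orbT// => i /negPf ->.
  exists g => //; rewrite -gE; set p := npoint _ _ _.
  have pz : p (Ordinal s0) = 0.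
    rewrite /p /npoint eqxx; apply/max_idPl; rewrite natrM natrX /gdelta.
    have -> : s%:R * 64 ^+ k * ((64 ^+ k)^-1 / s%:R) = 1 :> R.
      by field; rewrite ?gt_eqF ?exprn_gt0.
    by rewrite subrr.
  have v0 : vol s p = 0 by rewrite /vol (bigD1 (Ordinal s0))//= pz mul0r.
  split; last first.
    rewrite v0 subr0; apply: (big_vol y (\sum_i f i)%N) => //; last exact: sumf.
    by move: hs; rewrite (eq_bigr (fun i => (f i + 1)%N)) => [|i _]; [rewrite big_split/= sum1_card card_ord => /ltnW|rewrite addn1].
  split; last by rewrite v0 prodr_ge0.
  move=> x /forallP/(_ (Ordinal s0)) /andP[x0]; rewrite pz => x1.
  by have := le_lt_trans x0 x1; rewrite ltxx.
(* Either the rounded point itself, or a truncation lying exactly on the boundary of the simplex. *)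
have [h hf hs] : exists2 h : 'I_s -> nat, (forall i, h i <= f i)%N &
    ((\sum_i h i <= s * gm k)%N /\ ((forall i, h i = f i) \/ (\sum_i h i = s * gm k)%N)).
  have [hs|/ltnW hs] := leqP (\sum_i f i) (s * gm k).
    by exists f => //; split => //; left.
  have [h [hf hE]] := truncate_sum _ _ _ hs.
  by exists h => //; split; [rewrite hE|right].
case: hs => hs hs'.
have [g gG gE] := grid_of_npoint s k h hs.
exists g => //; rewrite -gE; set p := npoint _ _ _.
have pE i : p i = 1 - (h i)%:R * e.
  rewrite /p /npoint; apply/max_idPr; rewrite -/e.
  have : (h i)%:R * e <= (f i)%:R * e by rewrite ler_wpM2r ?(ltW e0)// ler_nat.
  by have := f1 i; have := ge0 i; lra.
have py i : y i <= p i.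
  rewrite pE; have : (h i)%:R * e <= (f i)%:R * e by rewrite ler_wpM2r ?(ltW e0)// ler_nat.
  by have := f1 i; lra.
have p0 i : 0 <= p i by have /andP[] := npoint_cube s k h i.
split; first exact: sub_of.
case: hs' => hs'.
  apply: le_trans (prod_sub_le_sum _ _ y p _) _ => [i|].
    by split; [exact: ge0|split; [exact: py|have /andP[] := npoint_cube s k h i]].
  rewrite -se; apply: ler_sum => i _; rewrite pE hs'.
  by have := f2 i; rewrite -natr1 mulrDl mul1r; lra.
apply: (@le_trans _ _ (vol s p)); first by rewrite gerBl prodr_ge0.
apply: (big_vol p (\sum_i h i)%N) => //; first by rewrite hs' leq_addr.
by rewrite natr_sum big_distrl/=; apply: ler_sum => i _; rewrite pE; lra.
Qed.

End Grid.

(** * Unnormalized discrepancy, reduction to grids and chaining *)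

Section Discrepancy.
Variable R : realType.

Definition dev (s N : nat) (x : nat -> 'I_s -> R) (y : 'I_s -> R) : R :=
  \sum_(k < N) (inbox R s y (x k))%:R - N%:R * vol R s y.

Lemma vol_bounds s y : in_cube R s y -> 0 <= vol R s y <= 1.
Proof.
move=> yc; rewrite /vol prodr_ge0 => [|i _]; last by have /andP[] := yc i.
by rewrite prodr_ile1// => i _; exact: yc.
Qed.

Lemma dev_norm_le s N x y : in_cube R s y -> `|dev s N x y| <= N%:R.
Proof.
move=> /vol_bounds /andP[v0 v1].
have s0 : 0 <= \sum_(k < N) (inbox R s y (x k))%:R :> R by rewrite sumr_ge0.
have s1 : \sum_(k < N) (inbox R s y (x k))%:R <= N%:R :> R.
  apply: (@le_trans _ _ (\sum_(k < N) 1)); last by rewrite sumr_const card_ord.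
  by apply: ler_sum => i _; case: (inbox _ _ _ _); rewrite ?ler01.
have n0 : 0 <= N%:R :> R by [].
have h1 : N%:R * vol R s y <= N%:R by rewrite ler_piMr.
have h2 : 0 <= N%:R * vol R s y by rewrite mulr_ge0.
by rewrite /dev ler_norml; apply/andP; split; lra.
Qed.

Lemma dev_normalized s N (x : nat -> 'I_s -> R) (y : 'I_s -> R) : (0 < N)%N ->
  `| (N%:R)^-1 * (#|[set k : 'I_N | [forall i, (0 <= x k i) && (x k i < y i)]]|)%:R
     - \prod_(i < s) y i | = `|dev s N x y| / N%:R :> R.
Proof.
move=> N0; have n0 : 0 < N%:R :> R by rewrite ltr0n.
rewrite -[X in _ = _ / X]ger0_norm// -normrV ?unitfE ?gt_eqF// -normrM; congr `|_|.
rewrite /dev mulrBl [N%:R * _]mulrC mulfK ?gt_eqF// mulrC; congr (_ * _ - _).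
rewrite -sum1_card natr_sum big_mkcond/=; apply: eq_bigr => k _.
by rewrite /inbox; case: ifPn; [rewrite inE/= => ->|rewrite notin_setE/= => /negP/negPf->].
Qed.

(** [sup] behaves as a supremum only on a nonempty bounded set: the corner 0 supplies a member, and
    1 is a bound. *)
Lemma star_discrepancy_le s N x c : (0 < N)%N ->
  star_discrepancy s N x <= c <->
  (forall y, in_cube R s y -> `|dev s N x y| <= c * N%:R).
Proof.
move=> N0; have n0 : 0 < N%:R :> R by rewrite ltr0n.
rewrite /star_discrepancy; set E := [set r : R | _].
have Ene : E !=set0.
  by eexists; exists (fun=> 0); split => [i|]; [rewrite lexx ler01|reflexivity].
have Eub : has_ubound E.
  exists 1 => r [y [yc ->]]; rewrite dev_normalized// ler_pdivrMr// mul1r.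
  exact: dev_norm_le.
split=> [h y yc|h].
  rewrite -ler_pdivrMr//; apply: le_trans h; apply: ub_le_sup => //.
  by exists y; split => //; rewrite dev_normalized.
apply: ge_sup => // r [y [yc ->]]; rewrite dev_normalized// ler_pdivrMr//; exact: h.
Qed.

Lemma dev_grid_bracket s k N x y (c : R) : (0 < s)%N -> (0 < k)%N -> in_cube R s y ->
  (forall f, f \in grid s k -> `|dev s N x (gpoint R s k f)| <= c) ->
  `|dev s N x y| <= c + N%:R * gdelta R k.
Proof.
move=> s0 k0 yc h.
have [[f fG [[fy fv] fd]] [g gG [[yg gv] gd]]] := grid_bracket R s k y s0 k0 yc.
have n0 : 0 <= N%:R :> R by [].
have cf : \sum_(i < N) (inbox R s (gpoint R s k f) (x i))%:R <=
    \sum_(i < N) (inbox R s y (x i))%:R :> R.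
  by apply: ler_sum => i _; rewrite ler_nat; case: (boolP (inbox _ _ _ _)) => // /fy ->.
have cg : \sum_(i < N) (inbox R s y (x i))%:R <=
    \sum_(i < N) (inbox R s (gpoint R s k g) (x i))%:R :> R.
  by apply: ler_sum => i _; rewrite ler_nat; case: (boolP (inbox _ _ _ _)) => // /yg ->.
move: (ler_wpM2l n0 fd) (ler_wpM2l n0 gd) (h f fG) (h g gG) cf cg.
by rewrite /dev !ler_norml !mulrBr => ? ? /andP[? ?] /andP[? ?] ? ?; apply/andP; split; lra.
Qed.

Lemma gdelta_small (e : R) : 0 < e -> exists2 k, (0 < k)%N & gdelta R k <= e.
Proof.
move=> e0; exists (Num.truncn e^-1).+1 => //; set k := _.+1.
have hk : e^-1 <= k%:R.
  have i0 : 0 <= e^-1 by rewrite invr_ge0 ltW.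
  by have /andP[_ /ltW] := truncn_itv i0.
rewrite /gdelta -[leRHS]invrK lef_pV2 ?posrE ?exprn_gt0 ?invr_gt0//.
apply: (le_trans hk); rewrite -natrX ler_nat ltnW//; exact: ltn_expl.
Qed.

(** Nothing is lost by testing only countably many corners, because the bracketing error
    [N * gdelta k] tends to 0 with the resolution. This serves measurability. *)
Lemma star_discrepancy_le_grid s N x c : (0 < s)%N -> (0 < N)%N ->
  star_discrepancy s N x <= c <->
  (forall k f, (0 < k)%N -> f \in grid s k ->
    `|dev s N x (gpoint R s k f)| <= c * N%:R).
Proof.
move=> s0 N0; rewrite star_discrepancy_le//; split=> [h k f k0 _|h y yc].
  by apply: h; exact: npoint_cube.
have n0 : 0 < N%:R :> R by rewrite ltr0n.
rewrite leNgt; apply/negP => hlt.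
have [|k k0 hk] := gdelta_small ((`|dev s N x y| - c * N%:R) / (N%:R * 2)).
  by rewrite divr_gt0 ?subr_gt0 ?mulr_gt0.
have := dev_grid_bracket s k N x y (c * N%:R) s0 k0 yc (h k^~ k0).
move: hk; rewrite ler_pdivlMr ?mulr_gt0//; lra.
Qed.

(** Selects for each corner a lower bracket at every level. Level 0 is the empty box, allowed since
    [gdelta 0 = 1], and it ends every chain. *)
Definition lower_choice (s : nat) (low : nat -> ('I_s -> R) -> 'I_s -> R) : Prop :=
  [/\ forall p, low 0%N p = (fun=> 0),
      forall j p, in_cube R s p -> [/\ in_cube R s (low j p), subbox R s (low j p) p &
        vol R s p - vol R s (low j p) <= gdelta R j] &
      forall j p, in_cube R s p -> (0 < j)%N ->
        exists2 f, f \in grid s j & low j p = gpoint R s j f].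

Lemma lower_choice_exists s : (0 < s)%N -> exists low, lower_choice s low.
Proof.
move=> s0.
have ch (jp : nat * ('I_s -> R)) : exists q : 'I_s -> R,
    (jp.1 = 0%N -> q = fun=> 0) /\ (in_cube R s jp.2 ->
    [/\ in_cube R s q, subbox R s q jp.2, vol R s jp.2 - vol R s q <= gdelta R jp.1 &
      ((0 < jp.1)%N -> exists2 f, f \in grid s jp.1 & q = gpoint R s jp.1 f)]).
  case: jp => [[|j] p]/=.
    exists (fun=> 0); split => // pc.
    have v0 : vol R s (fun=> 0) = 0 by rewrite /vol (bigD1 (Ordinal s0))//= mul0r.
    have /andP[p0 p1] := vol_bounds _ _ pc.
    split=> //; first by move=> i; rewrite lexx ler01.
      split; last by rewrite v0.
      move=> x /forallP/(_ (Ordinal s0)) /andP[x0 x1].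
      by have := le_lt_trans x0 x1; rewrite ltxx.
    by rewrite v0 subr0 /gdelta expr0 invr1.
  have [pc|npc] := pselect (in_cube R s p); last by exists (fun=> 0); split.
  have [[f fG [fs fd]] _] := grid_bracket R s j.+1 p s0 isT pc.
  exists (gpoint R s j.+1 f); split => // _; split => //; first exact: npoint_cube.
  by move=> _; exists f.
have [g hg] := choice ch; exists (fun j p => g (j, p)); split=> [p|j p pc|j p pc j0].
- exact: (hg (0%N, p)).1.
- by have [] := (hg (j, p)).2 pc.
- by have [_ _ _] := (hg (j, p)).2 pc; apply.
Qed.

(** Telescopes from level [K.+1] down to the empty box, whose deviation is 0; each lower bracket is
    again a grid point, so the hypothesis applies at the next level. *)
Lemma dev_chain s N x low (t : nat -> R) K : (0 < s)%N -> lower_choice s low ->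
  (forall j f, (j < K.+1)%N -> f \in grid s j.+1 ->
    `|dev s N x (gpoint R s j.+1 f) - dev s N x (low j (gpoint R s j.+1 f))| <= t j) ->
  forall f, f \in grid s K.+1 -> `|dev s N x (gpoint R s K.+1 f)| <= \sum_(j < K.+1) t j.
Proof.
move=> s0 [low0 lowP lowG]; elim: K => [|K IH] h f fG.
  rewrite big_ord1; have := h 0%N f isT fG; rewrite low0.
  suff -> : dev s N x (fun=> 0) = 0 by rewrite subr0.
  rewrite /dev /vol (bigD1 (Ordinal s0))//= mul0r mulr0 subr0 big1// => k _.
  case: (boolP (inbox _ _ _ _)) => // /forallP/(_ (Ordinal s0)) /andP[x0 x1].
  by have := le_lt_trans x0 x1; rewrite ltxx.
rewrite big_ord_recr/=; have hK := h K.+1 f (ltnSn _) fG.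
set p := gpoint R s K.+2 f in hK *.
have [g gG gE] := lowG K.+1 p (npoint_cube _ _ _ _) isT.
have := IH (fun j f' jK => h j f' (ltnW jK)) g gG; rewrite -gE => hg.
have := ler_normD (dev s N x (low K.+1 p)) (dev s N x p - dev s N x (low K.+1 p)).
rewrite [_ + (_ - _)]addrC subrK => /le_trans; apply; exact: lerD.
Qed.

Lemma dev_sub s N x p q : subbox R s q p ->
  dev s N x p - dev s N x q =
  \sum_(k < N) ((inbox R s p (x k) && ~~ inbox R s q (x k))%:R - (vol R s p - vol R s q)).
Proof.
move=> [qp _]; rewrite /dev sumrB sumr_const card_ord -[(vol R s p - _) *+ N]mulr_natl.
rewrite [X in _ = X - _](eq_bigr (fun k : 'I_N => (inbox R s p (x k))%:R - (inbox R s q (x k))%:R : R)).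
  by rewrite sumrB; ring.
move=> k _; case: (boolP (inbox R s q (x k))) => [/qp ->|_]; first by rewrite subrr.
by rewrite andbT subr0.
Qed.

End Discrepancy.

(** * Real-valued probabilities, and the product rule under proper differences *)

Section Independence.
Variables (R : realType) (d : measure_display) (T : measurableType d) (P : probability T R).
Implicit Types A B : set T.

Definition pr A : R := fine (P A).

Lemma prE A : measurable A -> P A = (pr A)%:E.
Proof. by move=> mA; rewrite /pr fineK// fin_num_measure. Qed.

Lemma pr_ge0 A : 0 <= pr A.
Proof. by rewrite /pr fine_ge0. Qed.

Lemma pr_setT : pr setT = 1.
Proof. by rewrite /pr probability_setT. Qed.

Lemma pr_set0 : pr set0 = 0.
Proof. by rewrite /pr measure0. Qed.

Lemma pr_setU A B : measurable A -> measurable B -> pr (A `|` B) <= pr A + pr B.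
Proof.
move=> mA mB; rewrite -lee_fin EFinD -!prE//; last exact: measurableU.
exact: measureU2.
Qed.

Lemma pr_setD A B : measurable A -> measurable B -> B `<=` A ->
  pr (A `\` B) = pr A - pr B.
Proof.
move=> mA mB BA; have pA : (P A < +oo)%E by rewrite prE// ltry.
apply: EFin_inj; rewrite EFinB -!prE//; last exact: measurableD.
by rewrite measureD// setIidr.
Qed.

Lemma pr_setC A : measurable A -> pr (~` A) = 1 - pr A.
Proof. by move=> mA; rewrite -setTD pr_setD// pr_setT. Qed.

Lemma pr_bigsetU (I : Type) (r : seq I) (Q : pred I) (A : I -> set T) :
  (forall i, measurable (A i)) ->
  pr (\big[setU/set0]_(i <- r | Q i) A i) <= \sum_(i <- r | Q i) pr (A i).
Proof.
move=> mA; have : measurable (\big[setU/set0]_(i <- r | Q i) A i) /\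
    pr (\big[setU/set0]_(i <- r | Q i) A i) <= \sum_(i <- r | Q i) pr (A i).
  elim/big_rec2: _ => [|i x B _ [mB hB]]; first by rewrite pr_set0.
  split; first exact: measurableU.
  by apply: (le_trans (pr_setU _ _ (mA i) mB)); rewrite lerD2l.
by case.
Qed.

Definition product_rule (N : nat) (F : nat -> set (set T)) : Prop :=
  forall D : nat -> set T, (forall n, F n (D n)) ->
    pr (\bigcap_(n in `I_N) D n) = \prod_(n < N) pr (D n).

Definition differences (F : nat -> set (set T)) (n : nat) : set (set T) :=
  [set C | exists A B, [/\ F n A, F n B, B `<=` A & C = A `\` B]].

Lemma measurable_differences F : (forall n A, F n A -> measurable A) ->
  forall n A, differences F n A -> measurable A.
Proof. by move=> mF n _ [A [B [FA FB _ ->]]]; apply: measurableD; exact: (mF n). Qed.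

(** Indices are converted one at a time. With [A \ B] at index [j], the intersection is a proper
    difference of the intersections with [A] and with [B] there; both obey the rule, and
    [pr A - pr B] factors out. *)
Lemma product_rule_differences N F : (forall n A, F n A -> measurable A) ->
  product_rule N F -> product_rule N (differences F).
Proof.
move=> mF h; have mF' := measurable_differences F mF.
suff H j : (j <= N)%N -> forall D : nat -> set T,
    (forall n, (n < j)%N -> differences F n (D n)) -> (forall n, (j <= n)%N -> F n (D n)) ->
    pr (\bigcap_(n in `I_N) D n) = \prod_(n < N) pr (D n).
  (* The induction wants members of [F n] at every [n >= N] as well, so arbitrary ones are put
     there. *)
  move=> D hD; pose D' n := if (n < N)%N then D n else xget set0 (F n).
  have [hn|nF] := pselect (forall n, exists A, F n A).
    have -> : \bigcap_(n in `I_N) D n = \bigcap_(n in `I_N) D' n.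
      by apply: eq_bigcapr => n /= nN; rewrite /D' nN.
    rewrite (H N)// => [|n|n]; first by apply: eq_bigr => n _; rewrite /D' ltn_ord.
      by rewrite /D' => ->.
    rewrite /D' leqNgt => /negPf ->; have [A FA] := hn n.
    exact: (xgetPex set0 (ex_intro _ A FA)).
  by exfalso; apply: nF => n; have [A [B [FA _ _ _]]] := hD n; exists A.
elim: j => [_ D _ hD|j IH jN D hD1 hD2]; first by apply: h => n; exact: hD.
have [A [B [FA FB BA DE]]] := hD1 j (ltnSn j).
pose E C n := if n == j then C else D n.
have EF C n : F j C -> (j <= n)%N -> F n (E C n).
  move=> FC; rewrite /E; case: eqP => [->//|/eqP nj jn].
  by apply: hD2; rewrite ltn_neqAle eq_sym nj.
have rule C : F j C -> pr (\bigcap_(n in `I_N) E C n) = \prod_(n < N) pr (E C n).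
  move=> FC; apply: IH; [exact: ltnW| |by move=> n; exact: EF].
  by move=> n nj; rewrite /E (ltn_eqF nj); apply: hD1; exact: ltnW.
have mD n : measurable (D n).
  by have [nj|nj] := leqP n j; [apply: (mF' n); exact: hD1|apply: (mF n); exact: hD2].
have mE C : F j C -> measurable (\bigcap_(n in `I_N) E C n).
  move=> FC; apply: bigcap_measurableType => n _; rewrite /E.
  by case: eqP => // _; exact: (mF j).
have -> : \bigcap_(n in `I_N) D n = (\bigcap_(n in `I_N) E A n) `\` (\bigcap_(n in `I_N) E B n).
  apply/seteqP; split => [w Dw|w [wA wB] n nN].
    split=> [n nN|wB].
      rewrite /E; case: eqP => [nj|_]; last exact: Dw.
      by have := Dw n nN; rewrite nj DE => -[].
    have := Dw j jN; rewrite DE => -[_]; apply.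
    by have := wB j jN; rewrite /E eqxx.
  have := wA n nN; rewrite /E; case: eqP => [->|//] Aw; rewrite DE; split => // Bw.
  apply: wB => m mN; rewrite /E; case: eqP => [//|mj].
  by have := wA m mN; rewrite /E; case: eqP.
rewrite pr_setD; [|exact: mE|exact: mE|]; last first.
  move=> w wB n nN; have := wB n nN; rewrite /E; case: eqP => // _; exact: BA.
rewrite !rule// [X in X - _](bigD1 (Ordinal jN))//= [X in _ - X](bigD1 (Ordinal jN))//=.
rewrite [RHS](bigD1 (Ordinal jN))//= /E !eqxx DE pr_setD//; [|exact: (mF j)..].
rewrite mulrBl; congr (_ * _ - _ * _); apply: eq_bigr => n nj.
all: by rewrite ifN// -[j]/(val (Ordinal jN)) val_eqE.
Qed.

End Independence.

(** * Exponential maximal inequality for a centred Bernoulli walk *)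

Section MaximalInequality.
Variables (R : realType) (d : measure_display) (T : measurableType d) (P : probability T R).
Variables (A : nat -> set T) (v : R).
Local Notation pr := (pr R d T P).
Hypothesis mA : forall n, measurable (A n).
Hypothesis v01 : 0 <= v <= 1.

(** The atoms generated by the first [size l] events; restricting to one of them replaces
    conditioning on the past. *)
Definition cylinder (l : seq bool) : set T :=
  \bigcap_(n in `I_(size l)) (if nth false l n then A n else ~` A n).

Hypothesis pr_cylinder : forall l,
  pr (cylinder l) = \prod_(n < size l) (if nth false l n then v else 1 - v).

Lemma measurable_cylinder l : measurable (cylinder l).
Proof.
by apply: bigcap_measurableType => n _; case: ifP => _ //; exact: measurableC.
Qed.

Lemma cylinder_rcons l b :
  cylinder (rcons l b) = cylinder l `&` (if b then A (size l) else ~` A (size l)).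
Proof.
apply/seteqP; split=> [w h|w [h hl] n].
  split=> [n nl|].
    by have := h n; rewrite /= size_rcons nth_rcons nl; apply; exact: ltnW.
  by have := h (size l); rewrite /= size_rcons nth_rcons ltnn eqxx; apply.
rewrite /= size_rcons ltnS nth_rcons leq_eqVlt => /predU1P[->|nl].
  by rewrite ltnn eqxx.
by rewrite nl; exact: h.
Qed.

Lemma pr_cylinder_rcons l b :
  pr (cylinder (rcons l b)) = pr (cylinder l) * (if b then v else 1 - v).
Proof.
rewrite !pr_cylinder size_rcons big_ord_recr/= nth_rcons ltnn eqxx; congr (_ * _).
by apply: eq_bigr => n _; rewrite nth_rcons ltn_ord.
Qed.

(* [hit sg t m k x]: the walk started at [x] at time [k], with increments
   [sg * (1_(A i) - v)], exceeds [t] within [m] steps. *)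
Fixpoint hit (sg t : R) (m k : nat) (x : R) : set T :=
  if t < x then setT else
  if m is m'.+1 then
    (A k `&` hit sg t m' k.+1 (x + sg * (1 - v))) `|`
    (~` A k `&` hit sg t m' k.+1 (x - sg * v))
  else set0.

Lemma measurable_hit sg t m k x : measurable (hit sg t m k x).
Proof.
elim: m k x => [|m IH] k x /=; case: ifP => _ //.
by apply: measurableU; apply: measurableI => //; exact: measurableC.
Qed.

Lemma hitP sg t m k x w n : (n <= m)%N ->
  t < x + sg * \sum_(k <= i < k + n) ((`[< A i w >])%:R - v) -> hit sg t m k x w.
Proof.
elim: m k x n => [|m IH] k x [|n]// nm.
- by rewrite addn0 big_geq// mulr0 addr0 /= => ->.
- by rewrite addn0 big_geq// mulr0 addr0 /= => ->.
- move=> h /=; case: ifP => // _; have lt : (k < k + n.+1)%N by rewrite addnS ltnS leq_addr.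
  rewrite (big_ltn lt) mulrDr addrA -addSnnS in h.
  have [Aw|nAw] := pselect (A k w); [left|right]; split => //; apply: (IH _ _ n) => //.
    by move: h; rewrite asboolT.
  by move: h; rewrite asboolF// sub0r mulrN.
Qed.

(** Under the quadratic bound for exp the linear terms cancel, as the step is centred, and the
    quadratic ones add up to [sg^2 lam^2 v (1 - v)]. *)
Lemma bernoulli_mgf_le (sg lam : R) : `|sg| <= 1 -> 0 <= lam -> lam <= 3 / 5 ->
  v * expR (lam * (sg * (1 - v))) + (1 - v) * expR (- (lam * (sg * v))) <=
  1 + lam ^+ 2 * (v * (1 - v)).
Proof.
move=> sg1 l0 l1; have /andP[v0 v1] := v01.
have sg2 : sg ^+ 2 <= 1 by move: sg1; rewrite ler_norml => /andP[? ?]; nra.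
have h1 : expR (lam * (sg * (1 - v))) <=
    1 + lam * (sg * (1 - v)) + (lam * (sg * (1 - v))) ^+ 2.
  apply: expR_le_quad; rewrite !normrM ger0_norm// [`|1 - v|]ger0_norm; last lra.
  rewrite (le_trans _ l1)// ler_piMr// mulr_ile1//; lra.
have h2 : expR (- (lam * (sg * v))) <= 1 + - (lam * (sg * v)) + (- (lam * (sg * v))) ^+ 2.
  apply: expR_le_quad; rewrite normrN !normrM ger0_norm// [`|v|]ger0_norm; last lra.
  rewrite (le_trans _ l1)// ler_piMr// mulr_ile1//; lra.
have w0 : 0 <= 1 - v by lra.
apply: (le_trans (lerD (ler_wpM2l v0 h1) (ler_wpM2l w0 h2))).
have -> : v * (1 + lam * (sg * (1 - v)) + (lam * (sg * (1 - v))) ^+ 2) +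
  (1 - v) * (1 + - (lam * (sg * v)) + (- (lam * (sg * v))) ^+ 2) =
  1 + sg ^+ 2 * (lam ^+ 2 * (v * (1 - v))) by ring.
by rewrite lerD2l ler_piMl// mulr_ge0 ?sqr_ge0 ?mulr_ge0.
Qed.

(** Doob's argument as a recursion on the remaining time [m]: above [t] the bound is at least 1;
    below it, the atom splits in two according to the next outcome, and averaging costs one factor
    [q]. *)
Lemma pr_cylinder_hit (sg t lam : R) m l x : `|sg| <= 1 -> 0 <= lam -> lam <= 3 / 5 ->
  pr (cylinder l `&` hit sg t m (size l) x) <=
  pr (cylinder l) * (expR (lam * (x - t)) * (1 + lam ^+ 2 * (v * (1 - v))) ^+ m).
Proof.
move=> sg1 l0 l1; have /andP[v0 v1] := v01.
set q := 1 + _; have q1 : 1 <= q.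
  by rewrite /q lerDl mulr_ge0 ?sqr_ge0 ?mulr_ge0//; lra.
have large m' y : t < y -> 1 <= expR (lam * (y - t)) * q ^+ m'.
  move=> ty; rewrite -[leLHS]mulr1 ler_pM ?exprn_ege1//.
  by apply: le_trans (expR_ge1Dx _); rewrite lerDl mulr_ge0// subr_ge0 ltW.
have pos y m' : 0 <= expR (lam * (y - t)) * q ^+ m'.
  by rewrite mulr_ge0 ?expR_ge0 ?exprn_ge0// (le_trans _ q1).
elim: m l x => [|m IH] l x /=; case: ifP => tx.
- by rewrite setIT ler_peMr ?pr_ge0// large.
- by rewrite setI0 pr_set0 mulr_ge0 ?pr_ge0.
- by rewrite setIT ler_peMr ?pr_ge0// (large m.+1).
rewrite setIUr !setIA -(cylinder_rcons l true) -(cylinder_rcons l false).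
apply: (le_trans (pr_setU _ _ _ _ _ _ _ _)); first exact/measurableI/measurable_hit/measurable_cylinder.
  exact/measurableI/measurable_hit/measurable_cylinder.
have := IH (rcons l true) (x + sg * (1 - v)); have := IH (rcons l false) (x - sg * v).
rewrite !size_rcons !pr_cylinder_rcons => hF hT; apply: (le_trans (lerD hT hF)).
have -> : lam * (x + sg * (1 - v) - t) = lam * (x - t) + lam * (sg * (1 - v)) by ring.
have -> : lam * (x - sg * v - t) = lam * (x - t) + - (lam * (sg * v)) by ring.
rewrite !expRD exprS.
set e0 := expR _; set e1 := expR _; set e2 := expR _.
have -> : pr (cylinder l) * v * (e0 * e1 * q ^+ m) + pr (cylinder l) * (1 - v) * (e0 * e2 * q ^+ m)
  = pr (cylinder l) * (e0 * q ^+ m) * (v * e1 + (1 - v) * e2) by ring.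
have -> : pr (cylinder l) * (e0 * (q * q ^+ m)) = pr (cylinder l) * (e0 * q ^+ m) * q by ring.
apply: ler_wpM2l; last exact: bernoulli_mgf_le.
by rewrite mulr_ge0 ?pr_ge0//; exact: pos.
Qed.

Lemma pr_hit_le (sg t lam : R) m : `|sg| <= 1 -> 0 <= lam -> lam <= 3 / 5 ->
  pr (hit sg t m 0 0) <= expR (- (lam * t) + m%:R * (lam ^+ 2 * (v * (1 - v)))).
Proof.
move=> sg1 l0 l1; have /andP[v0 v1] := v01.
have := pr_cylinder_hit sg t lam m [::] 0 sg1 l0 l1.
have -> : cylinder [::] = setT by apply/seteqP; split => // w _ n /=; rewrite ltn0.
rewrite setTI pr_setT mul1r sub0r mulrN => /le_trans; apply.
rewrite expRD expRM_natl ler_wpM2l ?expR_ge0// lerXn2r ?nnegrE ?expR_ge0 ?expR_ge1Dx//.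
by rewrite addr_ge0// mulr_ge0 ?sqr_ge0 ?mulr_ge0//; lra.
Qed.

End MaximalInequality.

(** * Boxes and strips of sample points, their walks, and measurability *)

Section UniformRows.
Variables (R : realType) (d : measure_display) (T : measurableType d) (P : probability T R).
Variable X : nat -> nat -> T -> R.
Hypothesis Xind : mutually_independent P (fun p : nat * nat => X p.1 p.2).
Hypothesis Xunif : forall n j, uniform01 P (X n j).
Variable s : nat.
Hypothesis s0 : (0 < s)%N.
Local Notation pr := (pr R d T P).

Definition rowrect (n : nat) (B : 'I_s -> set R) : set T :=
  [set w | forall i : 'I_s, B i (X n i w)].

Definition rowrects (n : nat) : set (set T) :=
  [set A | exists B : 'I_s -> set R, (forall i, measurable (B i)) /\ A = rowrect n B].

Lemma measurable_preimageX n j B : measurable B -> measurable (X n j @^-1` B).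
Proof. by move=> mB; rewrite -[_ @^-1` _]setTI; exact: (Xunif n j).1. Qed.

Lemma measurable_rowrect n B : (forall i, measurable (B i)) -> measurable (rowrect n B).
Proof.
move=> mB.
have -> : rowrect n B = \bigcap_(i in [set: 'I_s]) (X n i @^-1` B i).
  by apply/seteqP; split => w h i; [move=> _|]; exact: h.
by apply: fin_bigcap_measurable => // i _; exact: measurable_preimageX.
Qed.

Lemma pr_rows (r : seq nat) (B : nat -> 'I_s -> set R) : uniq r ->
  (forall n i, measurable (B n i)) ->
  pr [set w | forall n, n \in r -> rowrect n (B n) w] =
  \prod_(n <- r) \prod_(i < s) pr (X n i @^-1` B n i).
Proof.
move=> ur mB; pose J := [seq (n, val i) | n <- r, i <- enum 'I_s].
(* Pairs whose second index is at least [s] get the default [setT]; none of them occurs in [J]. *)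
pose B' (p : nat * nat) := if insub p.2 is Some i then B p.1 (i : 'I_s) else setT.
have B'E n (i : 'I_s) : B' (n, val i) = B n i by rewrite /B' /= valK.
have mB' p : measurable (B' p) by rewrite /B'; case: insub => [i|]; [exact: mB|exact: measurableT].
have uJ : uniq J.
  by apply: allpairs_uniq => //; [exact: enum_uniq|move=> [a b] [a' b'] _ _ [-> /val_inj ->]].
have := Xind J B' uJ (fun p _ => mB' p).
rewrite (eq_bigr (fun p => (pr (X p.1 p.2 @^-1` B' p))%:E)); last first.
  by move=> p _; rewrite prE//; exact: measurable_preimageX.
rewrite prodEFin big_allpairs_dep/= => h.
have -> : \prod_(n <- r) \prod_(i < s) pr (X n i @^-1` B n i) =
    \prod_(n <- r) \prod_(i <- enum 'I_s) pr (X n (val i) @^-1` B' (n, val i)).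
  by apply: eq_bigr => n _; rewrite big_enum/=; apply: eq_bigr => i _; rewrite B'E.
apply: EFin_inj; rewrite -h -prE.
  congr (P _); apply/seteqP; split=> [w hw [n i]/=|w hw n nr i].
    by move=> /allpairsP[[n' i'] /= [nr _ [-> ->]]]; rewrite B'E; exact: hw.
  have := hw (n, val i); rewrite /= B'E; apply.
  by apply/allpairsP; exists (n, i); rewrite mem_enum.
have -> : [set w | forall n, n \in r -> rowrect n (B n) w] =
    \bigcap_(n in [set n | n \in r]) rowrect n (B n) by [].
by apply: bigcap_measurableType => n _; exact: measurable_rowrect.
Qed.

Lemma pr_rowrect n B : (forall i, measurable (B i)) ->
  pr (rowrect n B) = \prod_(i < s) pr (X n i @^-1` B i).
Proof.
move=> mB; have := pr_rows [:: n] (fun=> B) isT (fun=> mB); rewrite big_seq1 => <-.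
congr pr; apply/seteqP; split=> [w h m|w h]; first by rewrite inE => /eqP ->.
by apply: h; rewrite inE.
Qed.

Lemma product_rule_rowrects N : product_rule R d T P N rowrects.
Proof.
move=> D hD; have [B hB] := choice hD.
have mB n i : measurable (B n i) by have [] := hB n.
have DE n : D n = rowrect n (B n) by have [] := hB n.
rewrite (eq_bigr (fun n : 'I_N => \prod_(i < s) pr (X n i @^-1` B n i))); last first.
  by move=> n _; rewrite DE pr_rowrect.
rewrite -(big_mkord xpredT (fun n => \prod_(i < s) pr (X n i @^-1` B n i))).
rewrite -[index_iota _ _]/(iota 0 (N - 0)) subn0 -pr_rows ?iota_uniq//; congr pr.
apply/seteqP; split=> [w h n|w h n nN].
  by rewrite mem_iota add0n => /andP[_ nN]; rewrite -DE; exact: h.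
by rewrite DE; apply: h; rewrite mem_iota.
Qed.

Definition box (y : 'I_s -> R) (n : nat) : set T := [set w | inbox R s y (fun i => X n i w)].

Lemma box_rowrect y n : box y n = rowrect n (fun i => `[0, y i[%classic).
Proof.
apply/seteqP; split=> [w /forallP h i|w h]; first by rewrite /= in_itv/=; exact: h.
by apply/forallP => i; have := h i; rewrite /= in_itv.
Qed.

Lemma measurable_box y n : measurable (box y n).
Proof. by rewrite box_rowrect; apply: measurable_rowrect => i; exact: measurable_itv. Qed.

Lemma pr_box y n : in_cube R s y -> pr (box y n) = vol R s y.
Proof.
move=> yc; rewrite box_rowrect pr_rowrect => [|i]; last exact: measurable_itv.
apply: eq_bigr => i _; have /andP[y0 y1] := yc i.
rewrite /pr (Xunif n i).2; last exact: measurable_itv.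
have -> : `[0, y i[%classic `&` `[0, 1[%classic = `[0, y i[%classic :> set R.
  apply/setIidl => x /=; rewrite !in_itv/= => /andP[-> xy]/=; exact: lt_le_trans xy y1.
rewrite lebesgue_measure_itv/= lte_fin; case: ltP => h; first by rewrite oppr0 adde0.
by apply/eqP; rewrite eq_le y0/=.
Qed.

Definition strip (p q : 'I_s -> R) (n : nat) : set T := box p n `\` box q n.

Lemma measurable_strip p q n : measurable (strip p q n).
Proof. by apply: measurableD; exact: measurable_box. Qed.

Lemma pr_strip p q n : in_cube R s p -> in_cube R s q -> subbox R s q p ->
  pr (strip p q n) = vol R s p - vol R s q.
Proof.
move=> pc qc [qp _]; rewrite pr_setD ?pr_box//; [exact: measurable_box..|].
by move=> w; exact: qp.
Qed.

(** Two rounds of differences: the first turns boxes into strips, the second yields complements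
    [setT \ strip]. The empty and the full rectangle keep the earlier sets available at each
    round. *)
Lemma pr_cylinder_strip p q l : in_cube R s p -> in_cube R s q -> subbox R s q p ->
  pr (cylinder d T (strip p q) l) =
  \prod_(n < size l) (if nth false l n then vol R s p - vol R s q
                      else 1 - (vol R s p - vol R s q)).
Proof.
move=> pc qc qp; pose F1 := differences d T rowrects; pose F2 := differences d T F1.
have m0 n A : rowrects n A -> measurable A.
  by move=> [B [mB ->]]; exact: measurable_rowrect.
have m1 n A : F1 n A -> measurable A.
  by apply: (measurable_differences d T rowrects) => k C; exact: m0.
have r2 : product_rule R d T P (size l) F2.
  by do 2 (apply: product_rule_differences => //); exact: product_rule_rowrects.
have F0T n : rowrects n setT.
  by exists (fun=> setT); split => //; apply/seteqP; split.
have F00 n : rowrects n set0.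
  exists (fun=> set0); split => //; apply/seteqP; split => // w h.
  exact: (h (Ordinal s0)).
have F0b y n : rowrects n (box y n).
  by exists (fun i => `[0, y i[%classic); split; [move=> i; exact: measurable_itv|exact: box_rowrect].
have F1T n : F1 n setT by exists setT, set0; rewrite setD0; split.
have F10 n : F1 n set0 by exists set0, set0; rewrite setD0; split.
have F1s n : F1 n (strip p q n).
  by exists (box p n), (box q n); split => //; move=> w; exact: qp.1.
rewrite r2 => [|n].
  apply: eq_bigr => n _; case: ifP => _; first exact: pr_strip.
  by rewrite pr_setC ?pr_strip//; exact: measurable_strip.
case: ifP => _; first by exists (strip p q n), set0; rewrite setD0; split.
by exists setT, (strip p q n); rewrite setTD; split.
Qed.

Lemma dev_walk p q n w : subbox R s q p ->
  dev R s n (fun k i => X k i w) p - dev R s n (fun k i => X k i w) q =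
  \sum_(0 <= k < 0 + n) ((`[< strip p q k w >])%:R - (vol R s p - vol R s q)).
Proof.
move=> qp; rewrite dev_sub// add0n big_mkord; apply: eq_bigr => k _; congr ((nat_of_bool _)%:R - _).
apply/idP/asboolP => [/andP[hp /negP hq]|[hp hq]]; first by split.
by apply/andP; split => //; apply/negP.
Qed.

(** The two signs of [sg] give both sides, whence the factor 2. One exceptional event serves all
    [n <= m]. *)
Lemma dev_walk_bound p q m (t lam : R) : in_cube R s p -> in_cube R s q ->
  subbox R s q p -> 0 <= lam -> lam <= 3 / 5 ->
  exists2 A : set T, measurable A /\
    pr A <= 2 * expR (- (lam * t) + m%:R *
      (lam ^+ 2 * ((vol R s p - vol R s q) * (1 - (vol R s p - vol R s q))))) &
    forall w n, ~ A w -> (n <= m)%N ->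
      `|dev R s n (fun k i => X k i w) p - dev R s n (fun k i => X k i w) q| <= t.
Proof.
move=> pc qc qp l0 l1; set v := vol R s p - vol R s q.
have v01 : 0 <= v <= 1.
  have /andP[p0 p1] := vol_bounds _ _ _ pc; have /andP[q0 q1] := vol_bounds _ _ _ qc.
  by rewrite /v; have := qp.2 => ?; apply/andP; split; lra.
have mS := measurable_strip p q.
have hS l := pr_cylinder_strip p q l pc qc qp.
pose H sg := hit R d T (strip p q) v sg t m 0 0.
exists (H 1 `|` H (-1)).
  split; first by apply: measurableU; exact: measurable_hit.
  apply: (le_trans (pr_setU _ _ _ _ _ _ _ _)); [exact: measurable_hit..|].
  rewrite mulr_natl mulr2n lerD//; apply: pr_hit_le => //.
    by rewrite normr1.
  by rewrite normrN1.
move=> w n nA nm; rewrite dev_walk//; set S := \sum_(_ <= _ < _) _.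
rewrite ler_norml leNgt [S <= t]leNgt; apply/andP; split; apply/negP => h; apply: nA.
  by right; apply: (hitP R d T (strip p q) v (-1) t m 0 0 w n nm); rewrite add0r mulN1r -/S ltrNr.
by left; apply: (hitP R d T (strip p q) v 1 t m 0 0 w n nm); rewrite add0r mul1r.
Qed.

(** Induction on [N] with an arbitrary centre [a]: membership of the last point in the box shifts
    the centre by 1. *)
Lemma measurable_dev_le N y (c : R) :
  measurable [set w | `|dev R s N (fun k i => X k i w) y| <= c].
Proof.
rewrite /dev; move: (N%:R * _) => a; elim: N a => [|N IH] a.
  have [h|h] := boolP (`|0 - a| <= c).
    rewrite [X in measurable X](_ : _ = setT)//; apply/seteqP; split => // w _ /=.
    by rewrite big_ord0.
  rewrite [X in measurable X](_ : _ = set0)//; apply/seteqP; split => // w /=.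
  by rewrite big_ord0 (negPf h).
rewrite [X in measurable X](_ : _ =
   (box y N `&` [set w | `|\sum_(k < N) (inbox R s y (fun i => X k i w))%:R - (a - 1)| <= c]) `|`
   (~` box y N `&` [set w | `|\sum_(k < N) (inbox R s y (fun i => X k i w))%:R - a| <= c])).
  by apply: measurableU; apply: measurableI => //; [|apply: measurableC]; exact: measurable_box.
apply/seteqP; split=> w /=; rewrite big_ord_recr/=.
  rewrite /box/=; case: (boolP (inbox R s y (fun i => X N i w))) => hb h; [left|right]; split=> //.
    by move: h; rewrite opprB addrA addrAC.
  by move: h; rewrite addr0.
rewrite /box/= => -[[-> h]|[/negP/negPf -> h]]; last by rewrite addr0.
by move: h; rewrite opprB addrA addrAC.
Qed.

Lemma measurable_star_discrepancy_le N (c : R) : (0 < N)%N ->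
  measurable [set w | star_discrepancy s N (fun k i => X k i w) <= c].
Proof.
move=> N0.
have -> : [set w | star_discrepancy s N (fun k i => X k i w) <= c] =
  \bigcap_(k in [set k | (0 < k)%N]) \bigcap_(f in [set f | f \in grid s k])
    [set w | `|dev R s N (fun k i => X k i w) (gpoint R s k f)| <= c * N%:R].
  apply/seteqP; split=> [w /=|w h /=].
    by move=> /star_discrepancy_le_grid h k k0 f fG; exact: h.
  by apply/star_discrepancy_le_grid => // k f k0 fG; exact: h.
apply: bigcap_measurableType => k _; apply: fin_bigcap_measurable => [|f _].
  exact: finite_finset.
exact: measurable_dev_le.
Qed.

End UniformRows.

(** * Failure probability in one dyadic block of sample sizes *)

Section Block.
Variables (R : realType) (d : measure_display) (T : measurableType d) (P : probability T R).
Variable X : nat -> nat -> T -> R.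
Hypothesis Xind : mutually_independent P (fun p : nat * nat => X p.1 p.2).
Hypothesis Xunif : forall n j, uniform01 P (X n j).
Local Notation pr := (pr R d T P).

Lemma four_pow_gt j : j.+1%:R <= 4 ^+ j :> R.
Proof.
elim: j => [|j IH]; first by rewrite expr0.
have h : 1 <= j.+1%:R :> R by rewrite ler1n.
by rewrite exprS -[j.+2%:R]natr1; lra.
Qed.

Lemma ln_succ_le s : (0 < s)%N -> ln s.+1%:R <= s%:R :> R.
Proof. by move=> s0; rewrite -natr1 addrC; apply: le_ln1Dx; rewrite (lt_le_trans _ (ler0n _ _))//; lra. Qed.

(** Take logarithms and put [k = j + 1 <= 4^j]. Since [9/128 * 200 > 14], the [a s] term pays for
    [s (1 + 9 k ln 2)], for [a ln (s + 1) <= a s] and for all powers of 2; the [b] term pays for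
    [b ln (M + 1) <= 2 b ln M], which uses [M >= 2]. *)
Lemma level_failure_le (a b : R) s M j : 1 < a -> 1 < b -> (0 < s)%N -> (1 < M)%N ->
  (expR 1 * 512 ^+ j.+1) ^+ s *
    (2 * expR (- (9 / 128 * 4 ^+ j * (200 * a * s%:R + 178 * b * ln M%:R)))) <=
  2^-1 * (s.+1%:R `^ (- a) * M.+1%:R `^ (- b)) * 2^-1 ^+ j.+1 :> R.
Proof.
move=> a1 b1 s0 M1; have /andP[l0 l1] := ln2_bounds R.
have p2 : expR (ln 2) = 2 :> R by rewrite lnK ?posrE.
have pI : 2^-1 = expR (- ln 2) :> R by rewrite expRN p2.
have p512 : 512 = expR (9%:R * ln 2) :> R by rewrite expRM_natl p2; lra.
rewrite {1}p512 -{2}p2 !pI /powR !pnatr_eq0/= -!expRM_natl -!expRD -expRM_natl -!expRD ler_expR.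
have s1 : 1 <= s%:R :> R by rewrite ler1n.
have ls := ln_succ_le s s0.
have lM : ln M.+1%:R <= 2 * ln M%:R :> R.
  have M0 : 0 < M%:R :> R by rewrite ltr0n ltnW.
  have h : M.+1%:R <= M%:R ^+ 2 :> R by rewrite -natrX ler_nat expnS expn1; nia.
  rewrite (_ : 2 * ln M%:R = ln (M%:R ^+ 2)); last by rewrite lnXn// mulr_natl.
  by rewrite ler_ln ?posrE ?exprn_gt0// ltr0n.
have lM0 : 0 <= ln M%:R :> R by rewrite ln_ge0 // ler1n ltnW.
have k4 := four_pow_gt j; have k1 : 1 <= j.+1%:R :> R by rewrite ler1n.
set k := j.+1%:R in k4 k1 *; set f := 4 ^+ j in k4 *; set S := s%:R in s1 ls *.
set L := ln 2 in l0 l1 *; set ls1 := ln s.+1%:R in ls *.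
set m := ln M%:R in lM lM0 *; set m1 := ln M.+1%:R in lM *.
have hk : k * L <= k * (7 / 10) by rewrite ler_wpM2l; lra.
have hS : S * (1 + k * (9 * L)) <= S * (1 + 63 / 10 * k) by rewrite ler_wpM2l; lra.
have hb : b * m1 <= f * (b * m) * 2.
  have bm : 0 <= b * m by rewrite mulr_ge0//; lra.
  have : b * m1 <= b * (2 * m) by rewrite ler_wpM2l//; lra.
  have : 1 * (b * m) <= f * (b * m) by rewrite ler_wpM2r//; lra.
  by lra.
have bm : 0 <= f * (b * m) by rewrite !mulr_ge0//; lra.
have ha : a * ls1 <= a * S by rewrite ler_wpM2l//; lra.
have aS : S <= a * S by rewrite ler_peMl//; lra.
have kaS : k * (a * S) <= f * (a * S) by rewrite ler_wpM2r//; lra.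
have kS : k * S <= k * (a * S) by rewrite ler_wpM2l//; lra.
have kaS1 : a * S <= k * (a * S) by rewrite ler_peMl//; lra.
have k1S : k <= k * S by rewrite ler_peMr//; lra.
lra.
Qed.

Lemma sum_half_le n : \sum_(j < n) 2^-1 ^+ j <= 2 :> R.
Proof.
rewrite -(big_mkord xpredT (fun j => 2^-1 ^+ j)).
have h : 1 - 2^-1 = 2^-1 :> R by lra.
by apply: (le_trans (sum_geometric_le R 2^-1 n _ _)); rewrite ?h ?invrK//; lra.
Qed.

(** At [j = 0] this is [v (1 - v) <= 1/4]; for larger [j] it follows from [64^j >= 4 16^j]. *)
Lemma variance_le (v : R) j : 0 <= v -> v <= 1 -> v <= gdelta R j ->
  v * (1 - v) <= (16 ^+ j)^-1 / 4.
Proof.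
move=> v0 v1; case: j => [_|j vd]; first by rewrite expr0 invr1; have := sqr_ge0 (v - 1 / 2); nra.
apply: (@le_trans _ _ v); first by nra.
apply: (le_trans vd); rewrite /gdelta -invfM lef_pV2 ?posrE ?mulr_gt0 ?exprn_gt0//.
rewrite (_ : 64 = 4 * 16 :> R); last lra.
rewrite exprMn mulrC ler_wpM2r ?exprn_ge0// -[leLHS]expr1.
by apply: ler_weXn2l => //; lra.
Qed.

Lemma block_bound (a b : R) s M : 1 < a -> 1 < b -> (0 < s)%N -> (0 < M)%N ->
  exists2 A : set T, measurable A /\
    pr A <= 2^-1 * (s.+1%:R `^ (- a) * M.+1%:R `^ (- b)) &
    forall w N, ~ A w -> (2 ^ M <= N < 2 ^ M.+1)%N ->
      star_discrepancy s N (fun k i => X k i w) <=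
      Num.sqrt ((200 * a * s%:R + 178 * b * ln M%:R) / N%:R).
Proof.
move=> a1 b1 s0 M0; set H := 200 * a * s%:R + 178 * b * ln M%:R.
pose Q : R := 2 ^+ M.
have Q0 : 0 < Q by rewrite exprn_gt0.
have lM0 : 0 <= ln M%:R :> R by rewrite ln_ge0// ler1n.
have s1 : 1 <= s%:R :> R by rewrite ler1n.
have H200 : 200 <= H.
  have : 1 * 1 <= a * s%:R by rewrite ler_pM//; lra.
  have : 0 <= b * ln M%:R by rewrite mulr_ge0//; lra.
  by rewrite /H; lra.
have NQ N : (2 ^ M <= N < 2 ^ M.+1)%N -> Q <= N%:R /\ N%:R <= 2 * Q.
  move=> /andP[h1 h2]; rewrite /Q -exprS -!natrX !ler_nat; split => //; exact: ltnW.
have [HQ|HQ] := leP (2 * Q) H.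
  exists set0; first by rewrite pr_set0 !mulr_ge0 ?powR_ge0//; split.
  move=> w N _ /NQ[N1 N2]; have N0 : 0 < N%:R :> R by lra.
  apply/star_discrepancy_le; first by rewrite -(ltr0n R).
  move=> y yc; apply: (le_trans (dev_norm_le _ _ _ _ _ yc)); rewrite ler_peMl ?(ltW N0)//.
  by rewrite -[leLHS]sqrtr1 ler_wsqrtr// ler_pdivlMr// mul1r; lra.
(* [M = 1] would mean [2 Q = 4], which is below [200 <= H]. *)
have M1 : (1 < M)%N.
  rewrite ltn_neqAle M0 andbT; apply/eqP => M1; move: HQ; rewrite /Q -M1 expr1; lra.
pose r : R := Num.sqrt (H / Q).
have r2 : r ^+ 2 * Q = H by rewrite sqr_sqrtr ?divfK ?gt_eqF// divr_ge0//; lra.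
have r0 : 0 < r by rewrite sqrtr_gt0 divr_gt0//; lra.
have rs : r ^+ 2 < 2 by rewrite -(ltr_pM2r Q0) r2.
have exK : exists k, gdelta R k <= r / 8.
  by have [|k _ hk] := gdelta_small R (r / 8); [rewrite divr_gt0|exists k].
(* [K.+1] is the first level with resolution at most [r / 8]; it is not 0, because [r^2 < 2] while
   [gdelta 0 = 1]. *)
case: (ex_minnP exK) => -[|K] hK minK.
  exfalso; move: hK; rewrite /gdelta expr0 invr1; nra.
have hK' : r / 8 < gdelta R K.
  by rewrite ltNge; apply/negP => /minK; rewrite ltnn.
have [low lowC] := lower_choice_exists R s s0.
have [low0 lowP lowG] := lowC.
(* [lam j] minimizes the exponent [- lam t + 2 Q lam^2 16^-j / 4] for the deviation [t j]; the
   minimum is [- 9/128 4^j H]. *)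
pose lam j : R := 3 / 8 * 8 ^+ j * r.
pose t j : R := 3 / 8 * 2^-1 ^+ j * (r * Q).
have lam_ge0 j : 0 <= lam j by rewrite !mulr_ge0 ?exprn_ge0// ltW.
(* The worst case is [j = K]. For [K = 0], [r < sqrt 2] suffices; otherwise minimality gives
   [r 64^K < 8], so [r 8^K < 1]. *)
have lam_le j : (j < K.+1)%N -> lam j <= 3 / 5.
  rewrite ltnS => jK; apply: (@le_trans _ _ (lam K)).
    rewrite /lam ler_wpM2r ?(ltW r0)//.
    by apply: ler_wpM2l; [lra|apply: ler_weXn2l => //; lra].
  rewrite /lam; move: hK'; clear -rs r0; case: K => [_|K]; first by rewrite expr0; nra.
  rewrite /gdelta (_ : 64 = 8 * 8 :> R); last lra.
  rewrite exprMn; set e := 8 ^+ _; have e8 : 8 <= e.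
    by rewrite /e exprS ler_peMr// exprn_ege1//; lra.
  rewrite -[X in _ < X]div1r ltr_pdivlMr; last by rewrite mulr_gt0//; lra.
  move=> h; have : r * e * e < 8 by lra.
  have : r * e * 8 <= r * e * e by rewrite ler_wpM2l// mulr_ge0//; lra.
  by lra.
(* The condition on [j] sits inside the conclusions, so that choice applies to all pairs of a level
   and a grid point. *)
have strips j f : exists A : set T, [/\ measurable A,
    (j < K.+1)%N -> pr A <= 2 * expR (- (9 / 128 * 4 ^+ j * H)) &
    (j < K.+1)%N -> forall w n, ~ A w -> (n <= 2 ^ M.+1)%N ->
      `|dev R s n (fun k i => X k i w) (gpoint R s j.+1 f) -
        dev R s n (fun k i => X k i w) (low j (gpoint R s j.+1 f))| <= t j].
  have [jK|jK] := boolP (j < K.+1)%N; last by exists set0; split.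
  set p := gpoint R s j.+1 f; have pc : in_cube R s p by exact: npoint_cube.
  have [qc qp vd] := lowP j p pc.
  have [A [mA hA] hw] := dev_walk_bound R d T P X Xind Xunif s s0 p (low j p)
     (2 ^ M.+1) (t j) (lam j) pc qc qp (lam_ge0 j) (lam_le j jK).
  exists A; split => // _; apply: (le_trans hA); rewrite ler_pM2l// ler_expR.
  set v := vol R s p - _ in vd hA *.
  have v01 : 0 <= v /\ v <= 1.
    have /andP[p0 p1] := vol_bounds _ _ _ pc; have /andP[q0 q1] := vol_bounds _ _ _ qc.
    by rewrite /v; have := qp.2 => ?; split; lra.
  have hv := variance_le v j v01.1 v01.2 vd.
  rewrite natrX exprS -/Q.
  apply: (@le_trans _ _ (- (lam j * t j) + 2 * Q * (lam j ^+ 2 * ((16 ^+ j)^-1 / 4)))).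
    rewrite lerD2l ler_wpM2l ?mulr_ge0 ?(ltW Q0)//.
    by rewrite ler_wpM2l ?sqr_ge0.
  rewrite /lam /t -r2.
  have e8 : 8 ^+ j = 2 ^+ j * 4 ^+ j :> R by rewrite -exprMn; congr (_ ^+ _); lra.
  have e16 : 16 ^+ j = 4 ^+ j * 4 ^+ j :> R by rewrite -exprMn; congr (_ ^+ _); lra.
  rewrite e8 e16 exprVn; set x2 := 2 ^+ j; set x4 := 4 ^+ j.
  have x20 : 0 < x2 by rewrite exprn_gt0.
  have x40 : 0 < x4 by rewrite exprn_gt0.
  have x24 : x2 ^+ 2 = x4 by rewrite -exprM mulnC exprM /x4; congr (_ ^+ _); lra.
  rewrite le_eqVlt; apply/orP; left; apply/eqP; rewrite -x24; field.
  by rewrite gt_eqF.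
have [Bd hBd] := choice (fun jf : {j : nat & grid_dom s j.+1} => strips (projT1 jf) (projT2 jf)).
pose B j (f : grid_dom s j.+1) := Bd (existT _ j f).
have BP j f := hBd (existT _ j f).
exists (\big[setU/set0]_(j < K.+1) \big[setU/set0]_(f in grid s j.+1) B j f).
  have mB j f : measurable (B j f) by have [] := BP j f.
  split; first by apply: bigsetU_measurable => j _; exact: bigsetU_measurable.
  apply: (le_trans (pr_bigsetU _ _ _ _ _ _ _ _ _)) => [j|]; first exact: bigsetU_measurable.
  set c := _ * (_ * _); have c0 : 0 <= c by rewrite !mulr_ge0 ?powR_ge0.
  apply: (@le_trans _ _ (\sum_(j < K.+1) c * 2^-1 ^+ j.+1)).
    apply: ler_sum => j _.
    apply: (le_trans (pr_bigsetU _ _ _ _ _ _ _ _ _)) => [f|]; first exact: mB.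
    apply: (@le_trans _ _ (\sum_(f in grid s j.+1) 2 * expR (- (9 / 128 * 4 ^+ j * H)))).
      by apply: ler_sum => f _; have [_ h _] := BP j f; exact: (h (ltn_ord j)).
    rewrite sumr_const -[leLHS]mulr_natl.
    apply: (le_trans _ (level_failure_le a b s M j a1 b1 s0 M1)).
    by rewrite ler_wpM2r ?card_grid// mulr_ge0 ?expR_ge0.
  rewrite -big_distrr/= -[leRHS]mulr1 ler_wpM2l//.
  rewrite (eq_bigr (fun j : 'I_K.+1 => 2^-1 * 2^-1 ^+ j)) => [|j _]; last by rewrite exprS.
  by rewrite -big_distrr/= mulrC ler_pdivrMr// mul1r sum_half_le.
move=> w N nw hN; have [N1 N2] := NQ N hN; have N0 : 0 < N%:R :> R by lra.
apply/star_discrepancy_le; first by rewrite -(ltr0n R).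
move=> y yc.
have hf f : f \in grid s K.+1 ->
    `|dev R s N (fun k i => X k i w) (gpoint R s K.+1 f)| <= 3 / 4 * (r * Q).
  move=> fG; apply: (le_trans (dev_chain R s N _ low t K s0 lowC _ f fG)).
    move=> j g jK gG; have [_ _ h] := BP j g; apply: (h jK); last by case/andP: hN => _ /ltnW.
    move=> Bw; apply: nw; rewrite (bigD1 (Ordinal jK))//=; left.
    by rewrite (bigD1 g)//=; left.
  rewrite /t -big_distrl/= -big_distrr/= ler_wpM2r ?mulr_ge0 ?(ltW r0) ?(ltW Q0)//.
  rewrite (_ : 3 / 4 = 3 / 8 * 2 :> R); last lra.
  by apply: ler_wpM2l; [rewrite divr_ge0|exact: sum_half_le].
apply: (le_trans (dev_grid_bracket R s K.+1 N _ y _ s0 isT yc hf)).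
(* The chain used [3/4 r Q]; the last bracketing adds at most [1/4 r Q], for a total of
   [r Q = sqrt (H Q) <= sqrt (H N)]. *)
have hd : N%:R * gdelta R K.+1 <= 2 * Q * (r / 8).
  by apply: ler_pM => //; exact/ltW/gdelta_gt0.
apply: (@le_trans _ _ (r * Q)); first lra.
have -> : r * Q = Num.sqrt (H * Q).
  rewrite -[H in RHS]r2 -mulrA -expr2 sqrtrM ?sqr_ge0// !sqrtr_sqr.
  by rewrite !ger0_norm ?(ltW r0) ?(ltW Q0).
rewrite -[X in _ <= _ * X](ger0_norm (ltW N0)) -sqrtr_sqr -sqrtrM; last by rewrite divr_ge0//; lra.
apply: ler_wsqrtr; rewrite expr2 mulrA divfK ?gt_eqF// ler_wpM2l//; lra.
Qed.

End Block.

(** * Tails of the zeta series *)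

Section Union.
Variable R : realType.

Lemma zeta_gt1 (a : R) : 1 < a -> 0 < zeta a - 1.
Proof.
move=> a1; have := sum_powRN_le_zeta R a 3 a1.
rewrite big_nat_recr//= big_nat1 powR1; have : 0 < 2 `^ (- a) :> R by rewrite powR_gt0.
lra.
Qed.

Lemma sum_powRN_succ_le (a : R) n : 1 < a ->
  \sum_(k < n) k.+2%:R `^ (- a) <= zeta a - 1.
Proof.
move=> a1; have := sum_powRN_le_zeta R a n.+2 a1.
rewrite big_ltn// powR1 -(big_mkord xpredT (fun k => k.+2%:R `^ (- a))).
rewrite (_ : \sum_(2 <= k < n.+2) k%:R `^ (- a) = \sum_(0 <= k < n) k.+2%:R `^ (- a)).
  lra.
by rewrite -[n.+2]/(2 + n)%N (big_nat_shift R (fun k => k%:R `^ (- a)) 2 n).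
Qed.

End Union.

(** * Union bound over all dimensions and dyadic blocks *)

Theorem theorem4 (R : realType) (d : measure_display) (T : measurableType d)
  (P : probability T R) (X : nat -> nat -> T -> R)
  (Xind : mutually_independent P (fun p : nat * nat => X p.1 p.2))
  (Xunif : forall n j, uniform01 P (X n j))
  (alpha beta : R) (ha : 1 < alpha) (hb : 1 < beta)
  (hab : (zeta alpha - 1) * (zeta beta - 1) < 1) :
  let B : R := 178 in
  let E := [set w : T | forall s N : nat, (1 <= s)%N -> (2 <= N)%N ->
      star_discrepancy s N (fun k i => X k i w) <=
      Num.sqrt (alpha * A_const s + beta * B * ln (log2 N%:R) / s%:R)
      * Num.sqrt (s%:R / N%:R)] in
  (measurable E /\ ((1 - (zeta alpha - 1) * (zeta beta - 1))%:E < P E)%E)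
  /\ A_const (R:=R) 2 <= 942.
Proof.
move=> B E; split; last exact: A_const2_le.
pose z := (zeta alpha - 1) * (zeta beta - 1).
have za := zeta_gt1 R alpha ha; have zb := zeta_gt1 R beta hb.
have z0 : 0 < z by rewrite mulr_gt0.
have mE : measurable E.
  have -> : E = \bigcap_(s in [set s | (1 <= s)%N]) \bigcap_(N in [set N | (2 <= N)%N])
    [set w | star_discrepancy s N (fun k i => X k i w) <=
      Num.sqrt (alpha * A_const s + beta * B * ln (log2 N%:R) / s%:R)
      * Num.sqrt (s%:R / N%:R)].
    by apply/seteqP; split => [w h s s1 N N2|w h s N s1 N2]; exact: h.
  apply: bigcap_measurableType => s s1; apply: bigcap_measurableType => N N2.
  by apply: (measurable_star_discrepancy_le R d T P) => //; exact: ltnW.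
split=> //.
(* The pair [(s, M)] stands for dimension [s + 1] and block [M + 1], so the exponent bases start at
   2, as in [zeta - 1]. *)
have blocks (sM : nat * nat) : exists A : set T, [/\ measurable A,
    pr R d T P A <= 2^-1 * (sM.1.+2%:R `^ (- alpha) * sM.2.+2%:R `^ (- beta)) &
    forall w N, ~ A w -> (2 ^ sM.2.+1 <= N < 2 ^ sM.2.+2)%N ->
      star_discrepancy sM.1.+1 N (fun k i => X k i w) <=
      Num.sqrt ((200 * alpha * sM.1.+1%:R + 178 * beta * ln sM.2.+1%:R) / N%:R)].
  have [A [mA pA] hA] := block_bound R d T P X Xind Xunif alpha beta
    sM.1.+1 sM.2.+1 ha hb isT isT.
  by exists A; split.
have [F hF] := choice blocks.
(* Finite squares of indices, increasing with [n]: continuity from below carries their bound to the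
   full union. *)
pose U n := \big[setU/set0]_(s < n) \big[setU/set0]_(M < n) F (val s, val M).
have mF sM : measurable (F sM) by have [] := hF sM.
have mU n : measurable (U n) by do 2 (apply: bigsetU_measurable => ? _).
(* The bound [z / 2 < z] is what makes the final inequality strict. *)
have pU n : pr R d T P (U n) <= z / 2.
  apply: (le_trans (pr_bigsetU _ _ _ _ _ _ _ _ _)) => [s|]; first exact: bigsetU_measurable.
  apply: (@le_trans _ _ (\sum_(s < n) \sum_(M < n)
      2^-1 * (s.+2%:R `^ (- alpha) * M.+2%:R `^ (- beta)))).
    apply: ler_sum => s _; apply: (le_trans (pr_bigsetU _ _ _ _ _ _ _ _ _)) => [//|].
    by apply: ler_sum => M _; have [] := hF (val s, val M).
  under eq_bigr do rewrite -big_distrr/= -big_distrr/=.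
  rewrite -big_distrr/= -big_distrl/= mulrC ler_pM2r//.
  apply: ler_pM; rewrite ?sum_powRN_succ_le// sumr_ge0// => i _; exact: powR_ge0.
have UE n : U n = \bigcup_(s < n) \bigcup_(M < n) F (s, M).
  rewrite (bigcup_mkord n (fun s => \bigcup_(M < n) F (s, M))); apply: eq_bigr => s _.
  by rewrite (bigcup_mkord n (fun M => F (val s, M))).
have ndU : nondecreasing_seq U.
  move=> m n mn; apply/subsetPset => w; rewrite !UE => -[s sm [M Mm Fw]].
  by exists s; [|exists M] => //=; [exact: leq_trans sm mn|exact: leq_trans Mm mn].
have mUU : measurable (\bigcup_n U n) by apply: bigcupT_measurable.
have pUU : (P (\bigcup_n U n) <= (z / 2)%:E)%E.
  have cv := @nondecreasing_cvg_mu _ _ _ P U mU mUU ndU.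
  rewrite -(cvg_lim _ cv)//; apply: lime_le; first by apply/cvg_ex; eexists; exact: cv.
  by near=> n; rewrite /= prE// lee_fin.
have subE : ~` E `<=` \bigcup_n U n.
  move=> w nE; apply: contrapT => nU; apply: nE => -[//|s] N _ N2.
  (* The block of [N] is [M + 1 = floor (log2 N)], positive because [N >= 2]. *)
  pose M := (trunc_log 2 N).-1.
  have N0 : (0 < N)%N by exact: ltnW.
  have M1 : (0 < trunc_log 2 N)%N by rewrite trunc_log_gt0.
  have hM : (2 ^ M.+1 <= N < 2 ^ M.+2)%N.
    by rewrite /M prednK// trunc_logP//= trunc_log_ltn.
  have [_ _ h] := hF (s, M).
  have nF : ~ F (s, M) w.
    move=> Fw; apply: nU; exists (maxn s M).+1 => //; rewrite UE.
    by exists s; [|exists M] => //=; rewrite ltnS ?leq_maxl ?leq_maxr.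
  apply: (le_trans (h w N nF hM)) => /=.
  have s0 : 0 < s.+1%:R :> R by rewrite ltr0n.
  have n0 : 0 < N%:R :> R by rewrite ltr0n.
  have l2 : 0 < ln 2 :> R by rewrite ln_gt0// ltr1n.
  have lM : ln M.+1%:R <= ln (log2 N%:R) :> R.
    have hl : M.+1%:R <= log2 N%:R :> R.
      rewrite /log2 ler_pdivlMr// mulr_natl -lnXn// ler_ln ?posrE ?exprn_gt0//.
      by rewrite -natrX ler_nat; case/andP: hM.
    by rewrite ler_ln ?posrE ?ltr0n// (lt_le_trans _ hl) ?ltr0n.
  have A200 := A_const_ge R s.+1 isT.
  have lM0 : 0 <= ln M.+1%:R :> R by rewrite ln_ge0// ler1n.
  have c0 : 0 <= alpha * A_const s.+1 + beta * B * ln (log2 N%:R) / s.+1%:R.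
    have lg0 : 0 <= ln (log2 N%:R) :> R by exact: le_trans lM.
    have a0 : 0 <= alpha * A_const s.+1 by apply: mulr_ge0; lra.
    have b0 : 0 <= beta * B by apply: mulr_ge0; rewrite /B; lra.
    by apply: addr_ge0 => //; apply: divr_ge0 => //; exact: mulr_ge0.
  rewrite -sqrtrM//; apply: ler_wsqrtr; rewrite mulrA ler_wpM2r ?invr_ge0 ?(ltW n0)//.
  rewrite [leRHS]mulrDl divfK ?gt_eqF// lerD//.
    rewrite [200 * _]mulrC ler_wpM2r ?(ltW s0)// ler_wpM2l//; lra.
  rewrite [178 * _]mulrC /B ler_wpM2l//; lra.
have mEc : measurable (~` E) by exact: measurableC.
have hE : P E = (1 - P (~` E))%E by rewrite -probability_setC// setCK.
rewrite hE prE// -EFinB lte_fin.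
have : (P (~` E) <= (z / 2)%:E)%E by apply: le_trans pUU; rewrite le_measure ?inE.
rewrite prE// lee_fin -/z => ?; lra.
Unshelve. all: by end_near.
Qed.
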